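(* Let $d\ge 3$, let $x\in\mathbb{R}^d$, and let $B=\{B(t),t\ge 0\}$ be a standard Brownian motion in $\mathbb{R}^d$ starting from $x$. Let $f\in CL(\mathbb{R}^d)$ be non-negative. Then the perpetual integral functional $\int_0^\infty f(B(t))\,dt$ exists (is finite) almost surely, its expectation equals $$E\left[\int_0^\infty f(B(t))\,dt\right]=\frac{2^{d/2-1}\Gamma(d/2-1)}{(2\pi)^{d/2}}\int_{\mathbb{R}^d}\frac{f(x+y)}{|y|^{d-2}}\,dy,$$ and its variance equals $$V(f):=E\left[\left(\int_0^\infty f(B(t))\,dt-E\left[\int_0^\infty f(B(t))\,dt\right]\right)^2\right]$$ $$=\frac{2^{d-2}\Gamma^2(d/2-1)}{(2\pi)^d}\left(2\int_{\mathbb{R}^d}\int_{\mathbb{R}^d}\frac{f(x+y)f(x+y+z)}{|y|^{d-2}|z|^{d-2}}\,dy\,dz-\left(\int_{\mathbb{R}^d}\frac{f(x+y)}{|y|^{d-2}}\,dy\right)^2\right).$$ Moreover, if $f$ is not identically zero, then $\int_0^\infty f(B(t))\,dt$ is a non-constant random variable (it is not almost surely equal to a constant); consequently, for $f\neq 0$ the right-hand side of the variance formula is strictly positive.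
   Context: $CL(\mathbb{R}^d)$ denotes the set of functions $f:\mathbb{R}^d\to\mathbb{R}$ that are continuous, bounded and belong to $L_1(\mathbb{R}^d)$ (Lebesgue measure). $|\cdot|$ is the Euclidean norm and $\Gamma$ is the Gamma function. Standard Brownian motion starting from $x$ means a process with continuous paths, $B(0)=x$, with independent increments, and such that for $0\le s<t$ the increment $B(t)-B(s)$ has density $(2\pi (t-s))^{-d/2}\exp\{-|y|^2/(2(t-s))\}$ on $\mathbb{R}^d$. *)

(* Defs.v *)
From HB Require Import structures.
From mathcomp Require Import all_boot all_order all_algebra.
From mathcomp Require Import all_classical all_reals all_analysis.
From mathcomp Require Import measurable_realfun.

Set Implicit Arguments.
Unset Strict Implicit.
Unset Printing Implicit Defensive.

Import Order.TTheory GRing.Theory Num.Theory.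
Import numFieldNormedType.Exports.

Local Open Scope classical_set_scope.
Local Open Scope ring_scope.

(* The product sigma-algebra on row vectors, as the library does for
   n.-tuple T; for T a realType it is the Borel sigma-algebra. *)
Section measurable_rV.
Context d (T : measurableType d) (n : nat).

Let coords : 'I_n -> 'rV[T]_n -> T := fun i v => v ord0 i.

Let rV_set0 : g_sigma_preimage coords set0.
Proof. exact: sigma_algebra0. Qed.

Let rV_setC A : g_sigma_preimage coords A -> g_sigma_preimage coords (~` A).
Proof. exact: sigma_algebraC. Qed.

Let rV_bigcup (F : _^nat) : (forall i, g_sigma_preimage coords (F i)) ->
  g_sigma_preimage coords (\bigcup_i (F i)).
Proof. exact: sigma_algebra_bigcup. Qed.

HB.instance Definition _ := @isMeasurable.Build (measure_tuple_display d)
  'rV[T]_n (g_sigma_preimage coords) rV_set0 rV_setC rV_bigcup.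

End measurable_rV.

Section measurable_fun_rV.
Context d1 d2 (T1 : measurableType d1) (T2 : measurableType d2).

Lemma measurable_coord n (i : 'I_n) :
  measurable_fun [set: 'rV[T2]_n] (fun v : 'rV[T2]_n => v ord0 i).
Proof.
move=> _ Y mY; rewrite setTI; apply: sub_sigma_algebra => /=.
rewrite -bigcup_seq/=; exists i => /=; first by rewrite mem_index_enum.
by exists Y => //; rewrite setTI.
Qed.

Lemma measurable_fun_rVP n (f : T1 -> 'rV[T2]_n) :
  measurable_fun [set: T1] f <->
  forall i, measurable_fun [set: T1] (fun x => f x ord0 i).
Proof.
split=> [mf i|mf].
  by apply: (measurableT_comp (measurable_coord i)).
move=> _ A mA; rewrite setTI.
move: A mA; apply: smallest_sub.
  split=> [|A mA|F mF] /=.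
  - by rewrite preimage_set0.
  - by rewrite setTD preimage_setC; exact: measurableC.
  - by rewrite preimage_bigcup; exact: bigcupT_measurable.
rewrite -bigcup_seq/= => A [i _ [B mB <-]].
by rewrite setTI; have := mf i measurableT B mB; rewrite setTI.
Qed.

End measurable_fun_rV.

Section lebesgue_rV.
Context (R : realType).
Local Open Scope ereal_scope.

(* Lebesgue measure on R^n, by slicing along the first coordinate: the
   measure of A in dimension n.+1 is the integral over t of the measure of
   {v | (t, v) in A} in dimension n. *)
Fixpoint lebesgue_rV (n : nat) : set 'rV[R]_n -> \bar R :=
  match n with
  | 0 => \d_(0%R : 'rV[R]_0)
  | m.+1 => fun A =>
      \int[lebesgue_measure]_t
        lebesgue_rV [set v : 'rV[R]_m | A (row_mx t%:M v)]
  end.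

Let consrV n (p : measurableTypeR R * 'rV[R]_n) : 'rV[R]_n.+1 :=
  row_mx p.1%:M p.2.

Let unconsrV n (v : 'rV[R]_n.+1) : measurableTypeR R * 'rV[R]_n :=
  (v ord0 ord0, \row_j v ord0 (lift ord0 j)).

Let consrVE n (p : measurableTypeR R * 'rV[R]_n) i :
  consrV p ord0 i = if unlift ord0 i is Some j then p.2 ord0 j else p.1.
Proof.
case: p => t v; rewrite /consrV mxE /=.
case: unliftP => [j ->|->].
  case: splitP => [k|k].
    by rewrite ord1.
  by rewrite /= => -[jk]; congr (v _ _); apply/val_inj.
case: splitP => [k _|k] //=.
by rewrite !ord1 mxE.
Qed.

Let consrVK n : cancel (@consrV n) (@unconsrV n).
Proof.
move=> [t v]; rewrite /unconsrV consrVE unlift_none/=; congr pair.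
by apply/rowP => j; rewrite mxE consrVE liftK.
Qed.

Let measurable_consrV n : measurable_fun setT (@consrV n).
Proof.
apply/measurable_fun_rVP => i.
under eq_fun do rewrite consrVE.
case: (unlift ord0 i) => [j|]; last exact: measurable_fst.
exact: (measurableT_comp (measurable_coord j)).
Qed.

Let measurable_unconsrV n : measurable_fun setT (@unconsrV n).
Proof.
apply/measurable_fun_pair => /=; first exact: measurable_coord.
apply/measurable_fun_rVP => i.
under eq_fun do rewrite mxE.
exact: measurable_coord.
Qed.

Section step.
Variables (n : nat) (m : {sigma_finite_measure set 'rV[R]_n -> \bar R}).

Let leb_step (A : set 'rV[R]_n.+1) :=
  \int[lebesgue_measure]_t m [set v : 'rV[R]_n | A (row_mx t%:M v)].

Let leb_stepE :
  leb_step = pushforward (lebesgue_measure \x m) (@consrV n).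
Proof.
apply/funext => A; apply: eq_integral => t _ /=; congr (m _).
by apply/seteqP; split=> v /=; rewrite /xsection /= inE.
Qed.

Let leb_step0 : leb_step set0 = 0.
Proof. by rewrite leb_stepE /pushforward preimage_set0 measure0. Qed.

Let leb_step_ge0 A : 0 <= leb_step A.
Proof. exact: integral_ge0. Qed.

Let leb_step_sigma_additive : semi_sigma_additive leb_step.
Proof.
move=> F mF tF mUF; rewrite leb_stepE /pushforward preimage_bigcup.
apply: measure_semi_sigma_additive.
- by move=> k; rewrite -[X in measurable X]setTI; exact: measurable_consrV.
- apply/trivIsetP => /= i j _ _ ij; rewrite -preimage_setI.
  by move/trivIsetP : tF => /(_ _ _ _ _ ij) ->//; rewrite preimage_set0.
- by rewrite -preimage_bigcup -[X in measurable X]setTI;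
    exact: measurable_consrV.
Qed.

HB.instance Definition _ := isMeasure.Build _ _ _
  leb_step leb_step0 leb_step_ge0 leb_step_sigma_additive.

Let leb_step_sigma_finite : sigma_finite setT leb_step.
Proof.
have /sigma_finiteP[F [TF ndF Foo]] :=
  sigma_finiteT (@lebesgue_measure R : {sigma_finite_measure set _ -> \bar R}).
have /sigma_finiteP[G [TG ndG Goo]] := sigma_finiteT m.
exists (fun k => @unconsrV n @^-1` (F k `*` G k)).
  rewrite -preimage_bigcup; apply/seteqP; split=> // v _ /=.
  have [k _ Fk] : (\bigcup_k F k) (v ord0 ord0) by rewrite -TF.
  have [l _ Gl] : (\bigcup_k G k) (unconsrV v).2 by rewrite -TG.
  exists (maxn k l) => //; split.
  - by move: Fk; exact/subsetPset/ndF/leq_maxl.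
  - by move: Gl; exact/subsetPset/ndG/leq_maxr.
move=> k; have [mF Fk] := Foo k; have [mG Gk] := Goo k; split.
  rewrite -[X in measurable X]setTI; apply: measurable_unconsrV => //.
  exact: measurableX.
rewrite leb_stepE /pushforward -comp_preimage.
rewrite (_ : _ \o _ = id); last by apply/funext => p /=; rewrite consrVK.
by rewrite preimage_id product_measure1E// lte_mul_pinfty// ge0_fin_numE.
Qed.

HB.instance Definition _ := Measure_isSigmaFinite.Build _ _ _
  leb_step leb_step_sigma_finite.

Local Lemma lebesgue_rV_step :
  exists mS : {sigma_finite_measure set 'rV[R]_n.+1 -> \bar R},
    forall A, mS A =
      \int[lebesgue_measure]_t m [set v : 'rV[R]_n | A (row_mx t%:M v)].
Proof. by exists leb_step. Qed.

End step.

Let lebesgue_rV_measure n :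
  exists m : {sigma_finite_measure set 'rV[R]_n -> \bar R},
    m = @lebesgue_rV n :> (set 'rV[R]_n -> \bar R).
Proof.
elim: n => [|n [m mE]]; first by exists (\d_(0%R : 'rV[R]_0)).
have [mS mSE] := lebesgue_rV_step m.
by exists mS; apply/funext => A; rewrite mSE mE.
Qed.

Let lebesgue_rV0 n : @lebesgue_rV n set0 = 0.
Proof. by have [m <-] := lebesgue_rV_measure n; exact: measure0. Qed.

Let lebesgue_rV_ge0 n A : 0 <= @lebesgue_rV n A.
Proof. by have [m <-] := lebesgue_rV_measure n; exact: measure_ge0. Qed.

Let lebesgue_rV_sigma_additive n : semi_sigma_additive (@lebesgue_rV n).
Proof.
by have [m <-] := lebesgue_rV_measure n; exact: measure_semi_sigma_additive.
Qed.

HB.instance Definition _ n := isMeasure.Build _ _ _ (@lebesgue_rV n)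
  (@lebesgue_rV0 n) (@lebesgue_rV_ge0 n) (@lebesgue_rV_sigma_additive n).

Let lebesgue_rV_sigma_finite n : sigma_finite setT (@lebesgue_rV n).
Proof. by have [m <-] := lebesgue_rV_measure n; exact: sigma_finiteT. Qed.

HB.instance Definition _ n := Measure_isSigmaFinite.Build _ _ _
  (@lebesgue_rV n) (@lebesgue_rV_sigma_finite n).

Lemma lebesgue_rV_box n (A : 'I_n -> set (measurableTypeR R)) :
  (forall i, measurable (A i)) ->
  lebesgue_rV [set v : 'rV[R]_n | forall i, A i (v ord0 i)] =
  \prod_(i < n) lebesgue_measure (A i).
Proof.
elim: n A => [|n IH] A mA.
  by rewrite big_ord0 /= diracE mem_set//= => -[].
rewrite big_ord_recl -IH//=.
rewrite (eq_integral (fun t => (\1_(A ord0) t)%:E *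
    lebesgue_rV [set v : 'rV[R]_n | forall i, A (lift ord0 i) (v ord0 i)])).
  rewrite ge0_integralZr//.
    by rewrite integral_indic// setIT.
  by apply/measurable_EFinP; exact: measurable_indic.
move=> t _; rewrite indicE.
have AE (v : 'rV[R]_n) : (forall i, A i (row_mx t%:M v ord0 i)) <->
    A ord0 t /\ forall i, A (lift ord0 i) (v ord0 i).
  split=> [H|[At Av] i].
    split; first by have := H ord0; rewrite (consrVE (t, v)) unlift_none.
    by move=> i; have := H (lift ord0 i); rewrite (consrVE (t, v)) liftK.
  by rewrite (consrVE (t, v)); case: unliftP => [j ->|->].
have [tA|tA] := boolP (t \in A ord0).
  rewrite mul1e; congr lebesgue_rV; apply/seteqP; split=> v /=.
    by move=> /AE[].
  by move=> Av; apply/AE; split=> //; exact: set_mem.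
rewrite mul0e -[RHS](measure0 (@lebesgue_rV n)); congr lebesgue_rV.
apply/seteqP; split=> v //= /AE[At _].
by move: tA; rewrite notin_setE.
Qed.

End lebesgue_rV.
Arguments lebesgue_rV {R n}.

Section notions.
Context (R : realType).

(* The norm of the library on row vectors is the sup norm. *)
Definition enorm n (v : 'rV[R]_n) : R := Num.sqrt (\sum_(i < n) v ord0 i ^+ 2).

Definition Gamma (a : R) : R :=
  \int[lebesgue_measure]_(t in `]0, +oo[) (t `^ (a - 1) * expR (- t)).

Definition CL n (f : 'rV[R]_n -> R) : Prop :=
  [/\ continuous f, bounded_fun (f : 'rV[R]_n -> R^o)
    & lebesgue_rV.-integrable setT (EFin \o f)].

Definition heat_kernel n (t : R) (y : 'rV[R]_n) : R :=
  (2 * pi * t) `^ (- (n%:R / 2)) * expR (- (enorm y ^+ 2 / (2 * t))).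

Definition mutually_independent dT (T : measurableType dT)
    (P : probability T R) dV (V : measurableType dV) n (X : 'I_n -> T -> V) :=
  forall A : 'I_n -> set V, (forall i, measurable (A i)) ->
    P (\bigcap_i X i @^-1` A i) = (\prod_(i < n) P (X i @^-1` A i))%E.

(* Only the values B t with 0 <= t are constrained. *)
Record brownian_motion dT (T : measurableType dT) (P : probability T R)
    n (x : 'rV[R]_n) (B : R -> T -> 'rV[R]_n) : Prop := BrownianMotion {
  bm_measurable : forall t, 0 <= t -> measurable_fun setT (B t) ;
  bm_continuous : forall w, {within `[0, +oo[, continuous (B ^~ w)} ;
  bm_start : forall w, B 0 w = x ;
  bm_independent : forall (k : nat) (t : nat -> R), 0 <= t 0%N ->
    (forall i, (i < k)%N -> t i < t i.+1) ->
    mutually_independent P (fun (i : 'I_k) w => B (t i.+1) w - B (t i) w) ;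
  bm_density : forall s t, 0 <= s -> s < t ->
    forall A : set 'rV[R]_n, measurable A ->
    P [set w | A (B t w - B s w)] =
      (\int[lebesgue_rV]_(y in A) (heat_kernel (t - s) y)%:E)%E }.

(* As a Rintegral, this is 0 on the paths where the integral is infinite. *)
Definition perpetual_integral T n (f : 'rV[R]_n -> R) (B : R -> T -> 'rV[R]_n)
    (w : T) : R :=
  \int[lebesgue_measure]_(t in `[0, +oo[) f (B t w).

End notions.

(* Main.v *)
(* With p_t the heat kernel and U(v) := \int_0^oo E f(v + B_t) dt, everything
   follows from Tonelli's theorem:
   - \int_0^oo p_t(y) dt = K / |y|^(d-2), by the substitution t = |y|^2 / (2u),
     and this turns U(x), the mean of the functional, into the stated integral;
   - U is bounded: the times t <= 1 contribute at most sup f, and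
     p_t <= t^(-3/2) for t >= 1;
   - by independence of the increments,
     E[g(B_s) \int_s^oo f(B_t) dt] = E[g(B_s) U(B_s)], and half of the second
     moment is the integral over s of the case g = f.
   If the functional were almost surely a constant c, then
   \int_t^oo f(B_r) dr >= c - t sup f, and taking for g the indicator of
   {U < c - t sup f} would give U >= c almost everywhere as t -> 0.  Then
   E \int_1^oo f(B_r) dr = E U(B_1) >= c = E \int_0^oo f(B_r) dr, so that
   E \int_0^1 f(B_r) dr = 0 and f = 0. *)

Require Import Defs.
From HB Require Import structures.
From mathcomp Require Import all_boot all_order all_algebra.
From mathcomp Require Import all_classical all_reals all_analysis.
From mathcomp Require Import measurable_realfun.
From mathcomp Require Import ring lra.

Set Implicit Arguments.
Unset Strict Implicit.
Unset Printing Implicit Defensive.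

Import Order.TTheory GRing.Theory Num.Theory.
Import numFieldNormedType.Exports.

Local Open Scope classical_set_scope.
Local Open Scope ring_scope.

(** * Joint measurability and densities *)

(** Integrals of nonnegative functions stay in the extended reals, so that Tonelli's theorem asks
    only for joint measurability in time and chance; continuity of the paths is used for nothing
    else. Finiteness is proved afterwards, where a subtraction needs it: in the variance, and when a
    common term is cancelled in the non-constancy argument. Independence is used for two successive
    increments only: they give the law of (B_s, B_(s+u)), which replaces conditional expectations
    and the Markov property. Positivity of the heat kernel turns statements about B_t into
    statements that hold Lebesgue-almost everywhere, and back. *)

Lemma measurable_fun_countable_glue d1 d2 (T1 : measurableType d1)
    (T2 : measurableType d2) (C : countType) (q : T1 -> C) (g : C -> T1 -> T2) :
  (forall c, measurable (q @^-1` [set c])) ->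
  (forall c, measurable_fun setT (g c)) ->
  measurable_fun setT (fun x => g (q x) x).
Proof.
move=> mq mg _ A mA; rewrite setTI.
rewrite (_ : _ @^-1` _ =
    \bigcup_(c in [set: C]) (q @^-1` [set c] `&` g c @^-1` A)); last first.
  apply/seteqP; split=> [x Ax|x [c _ [/= <-]]] //.
  by exists (q x).
apply: countable_bigcupT_measurable; first exact: countableP.
by move=> c; apply: measurableI => //; rewrite -[X in measurable X]setTI;
  apply: mg.
Qed.

(* Carathéodory: round the continuous variable down to a multiple of 1/(n+1). *)
Lemma measurable_fun_uncurry_continuous d (T : measurableType d) (R : realType)
    (G : R -> T -> R) :
  (forall t, measurable_fun setT (G t)) -> (forall w, continuous (G ^~ w)) ->
  measurable_fun setT (fun p : measurableTypeR R * T => G p.1 p.2).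
Proof.
move=> mG cG.
pose q n (t : R) : int := Num.floor (t * n.+1%:R).
apply: (@measurable_fun_cvg _ _ _ _
  (fun n p => G ((q n p.1)%:~R / n.+1%:R) p.2)).
- move=> n; apply: (@measurable_fun_countable_glue _ _ _ _ _ (fun p => q n p.1)
    (fun (c : int) (p : measurableTypeR R * T) => G (c%:~R / n.+1%:R) p.2)).
    move=> c; rewrite (_ : _ @^-1` _ =
      fst @^-1` `[c%:~R / n.+1%:R, (c + 1)%:~R / n.+1%:R[%classic).
      by rewrite -[X in measurable X]setTI; apply: measurable_fst.
    apply/seteqP; split=> -[t w] /=;
      rewrite in_itv /= ler_pdivrMr// ltr_pdivlMr//.
      by move=> <-; rewrite /q Num.Theory.floor_le floorD1_gt.
    exact: floor_def.
  by move=> c; exact: (measurableT_comp (mG _)).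
move=> [t w] _ /=.
apply: (@cvg_comp _ _ _ (fun n => (q n t)%:~R / n.+1%:R) (G ^~ w) _ (nbhs t));
  last exact: cG.
apply: (@squeeze_cvgr _ _ _ _ (fun n => t - n.+1%:R^-1) (cst t)); last 2 first.
- rewrite -[X in _ --> X]subr0; apply: cvgB; first exact: cvg_cst.
  exact: cvg_harmonic.
- exact: cvg_cst.
apply: nearW => n;
  rewrite ler_pdivlMr// ler_pdivrMr// mulrBl mulVf ?pnatr_eq0//.
have := ltW (floorD1_gt (t * n.+1%:R)); rewrite intrD -lerBlDr => ->.
exact: Num.Theory.floor_le.
Qed.

Lemma continuous_into_rV (R : realType) (S : topologicalType) n
    (g : S -> 'rV[R]_n) :
  (forall i, continuous (fun s => g s ord0 i)) -> continuous g.
Proof.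
move=> cg s; apply/cvg_ballP => e e0.
have : \forall s' \near s, forall i, ball (g s ord0 i) e (g s' ord0 i).
  apply: filter_forall => i.
  exact: (cg i s _ (nbhsx_ballx (g s ord0 i) e e0)).
by apply: filterS => s' H; split=> // i j; rewrite ord1; exact: H.
Qed.

(** The sigma-algebra on row vectors is generated by the coordinates, not by the open sets, so
    continuity does not give measurability at once. By induction on the dimension, [f] is measurable
    in the last coordinates and continuous in the first, which is the Carathéodory situation. *)
Lemma continuous_rV_measurable (R : realType) n (f : 'rV[R]_n -> R) :
  continuous f -> measurable_fun setT f.
Proof.
elim: n f => [|n IH] f cf.
  rewrite (_ : f = cst (f 0)); first exact: measurable_cst.
  by apply/funext => v; congr f; apply/rowP => -[].
pose un (v : 'rV[R]_n.+1) : measurableTypeR R * 'rV[R]_n :=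
  (v ord0 ord0, \row_j v ord0 (lift ord0 j)).
have mun : measurable_fun setT un.
  apply/measurable_fun_pair => /=; first exact: measurable_coord.
  apply/measurable_fun_rVP => i.
  under eq_fun do rewrite mxE.
  exact: measurable_coord.
pose G (t : R) (v : 'rV[R]_n) := f (row_mx t%:M v).
rewrite (_ : f = (fun p => G p.1 p.2) \o un); last first.
  apply/funext => v; rewrite /G /un /=; congr f; apply/rowP => j.
  rewrite mxE; case: splitP => k jk; rewrite !mxE ?(ord1 k).
    by rewrite mulr1n; congr (v _ _); apply/val_inj; rewrite /= jk (ord1 k).
  by congr (v _ _); apply/val_inj; rewrite /= jk.
apply: measurableT_comp mun; apply: measurable_fun_uncurry_continuous.
  move=> t; apply: IH => v; apply: continuous_comp; last exact: cf.
  apply: continuous_into_rV => i {}v; under eq_fun do rewrite mxE.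
  case: splitP => k _; last exact: coord_continuous.
  by apply: (@cvg_cst R^o); exact: (nbhs_filter v).
move=> v t; apply: continuous_comp; last exact: cf.
apply: continuous_into_rV => i {}t; under eq_fun do rewrite mxE.
case: splitP => k _; last exact: cvg_cst.
rewrite (ord1 k) mxE; under eq_fun do rewrite mxE mulr1n.
exact: cvg_id.
Qed.

Section density.
Import HBNNSimple.

(** The hypothesis is the case of an indicator; linearity gives simple functions, and monotone
    convergence along [nnsfun_approx] gives the rest. *)
Lemma ge0_integral_density d (T : measurableType d) (R : realType)
    (m mu : {measure set T -> \bar R}) (p : T -> R) :
  measurable_fun setT p -> (forall y, 0 <= p y) ->
  (forall A, measurable A -> m A = \int[mu]_(y in A) (p y)%:E)%E ->
  forall h : T -> \bar R, measurable_fun setT h -> (forall y, 0 <= h y)%E ->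
  (\int[m]_y h y = \int[mu]_y (h y * (p y)%:E))%E.
Proof.
move=> mp p0 mE h mh h0.
pose h_ := nnsfun_approx measurableT mh.
have cvh y : (fun n => (h_ n y)%:E) @ \oo --> h y by exact: cvg_nnsfun_approx.
have ndh y : {homo (fun n => (h_ n y)%:E) : a b / (a <= b)%N >-> (a <= b)%E}.
  by move=> a b ab; rewrite lee_fin; exact/lefP/nd_nnsfun_approx.
transitivity (limn (fun n => \int[m]_y (h_ n y)%:E))%E.
  rewrite -monotone_convergence//.
  - by apply: eq_integral => y _; apply/esym/cvg_lim => //; exact: cvh.
  - by move=> n; exact/measurable_EFinP.
  - by move=> n y _; rewrite lee_fin.
transitivity (limn (fun n => \int[mu]_y ((h_ n y)%:E * (p y)%:E)))%E;
  last first.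
  rewrite -monotone_convergence//.
  - apply: eq_integral => y _; apply/cvg_lim => //.
    by apply: cvgeZr => //; exact: cvh.
  - by move=> n; apply: emeasurable_funM => //; exact/measurable_EFinP.
  - by move=> n y _; rewrite mule_ge0// lee_fin.
  - by move=> y _ a b ab; apply: lee_wpmul2r; [rewrite lee_fin|exact: ndh].
congr (limn _); apply/funext => n.
under eq_integral do rewrite fimfunE -fsumEFin//.
rewrite ge0_integral_fsum//=; last 2 first.
  - by move=> r; exact/measurable_EFinP/measurableT_comp.
  - by move=> r y _; rewrite EFinM nnfun_muleindic_ge0.
under [RHS]eq_integral.
  move=> y _; rewrite fimfunE -fsumEFin// ge0_mule_fsuml; last first.
    by move=> r; rewrite EFinM nnfun_muleindic_ge0.
  over.
rewrite ge0_integral_fsum//=; last 2 first.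
  - by move=> r; apply: emeasurable_funM => //;
    exact/measurable_EFinP/measurableT_comp.
  - by move=> r y _; apply: mule_ge0;
    [rewrite EFinM nnfun_muleindic_ge0|rewrite lee_fin].
apply: eq_fsbigr => r _.
under [RHS]eq_integral do rewrite EFinM -muleA.
have mI := measurable_sfunP (h_ n) (measurable_set1 r).
(* The sum runs over all real levels. A negative one has an empty preimage; the others may be pulled
   out of a nonnegative integral. *)
have [r0|r0] := ltP r 0.
  rewrite preimage_nnfun0//.
  under eq_integral do rewrite indic0 mulr0.
  under [RHS]eq_integral do rewrite indic0 mul0e mule0.
  by rewrite !integral0.
rewrite integralZl_indic_nnsfun//.
rewrite (@ge0_integralZl _ _ _ mu _ measurableT
  (fun y => (\1_(h_ n @^-1` [set r]) y)%:E * (p y)%:E)%E); last 3 first.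
  - by apply: emeasurable_funM; exact/measurable_EFinP.
  - by move=> y _; apply: mule_ge0; rewrite lee_fin.
  - by rewrite lee_fin.
congr (_ * _)%E.
rewrite integral_indic// setIT mE//.
rewrite [LHS]integral_mkcond; apply: eq_integral => y _.
by rewrite patchE indicE; case: ifPn => _; rewrite ?mul1e ?mul0e.
Qed.

End density.

(** * Restricted Tonelli theorem, translation invariance *)

Section tonelli_restricted.
Local Open Scope ereal_scope.
Context d1 d2 (T1 : measurableType d1) (T2 : measurableType d2) (R : realType).
Variables (m1 : {sigma_finite_measure set T1 -> \bar R})
  (m2 : {sigma_finite_measure set T2 -> \bar R}).
Variables (D : set T1) (mD : measurable D) (f : T1 * T2 -> \bar R).
Hypotheses (mf : measurable_fun setT f) (f0 : forall p, 0 <= f p).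

(** Extension by 0 in the first variable reduces both restricted statements to the unrestricted
    ones. *)
Let g := f \_ (D `*` setT).

Let mg : measurable_fun setT g.
Proof.
apply/(measurable_restrictT f); first exact: measurableX.
exact: measurable_funS mf.
Qed.

Let g0 p : 0 <= g p.
Proof. by rewrite /g patchE; case: ifPn. Qed.

Let gE x y : g (x, y) = if x \in D then f (x, y) else 0.
Proof. by rewrite /g patchE in_setX in_setT andbT. Qed.

Lemma measurable_fun_integral_in :
  measurable_fun setT (fun y => \int[m1]_(x in D) f (x, y)).
Proof.
rewrite (_ : (fun _ => _) = (fun y => \int[m1]_x g (x, y))).
  exact: (@measurable_fun_fubini_tonelli_G _ _ _ _ _ m1 g).
apply/funext => y; rewrite integral_mkcond; apply: eq_integral => x _.
by rewrite patchE gE.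
Qed.

Lemma tonelli_in :
  \int[m1]_(x in D) \int[m2]_y f (x, y) = \int[m2]_y \int[m1]_(x in D) f (x, y).
Proof.
transitivity (\int[m1]_x \int[m2]_y g (x, y)).
  rewrite integral_mkcond; apply: eq_integral => x _.
  rewrite patchE; case: ifPn => xD.
    by apply: eq_integral => y _; rewrite gE xD.
  by rewrite integral0_eq// => y _; rewrite gE (negbTE xD).
rewrite fubini_tonelli//; apply: eq_integral => y _.
rewrite [RHS]integral_mkcond; apply: eq_integral => x _.
by rewrite patchE gE.
Qed.

End tonelli_restricted.

Section translation.
Context (R : realType).
Local Notation mu := (@lebesgue_measure R).

Lemma measurable_translate (a : R) :
  measurable_fun setT (fun t : measurableTypeR R => a + t : measurableTypeR R).
Proof. by apply: measurable_funD => //; exact: measurable_cst. Qed.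

(** Half-open intervals determine Lebesgue measure, and translation keeps their lengths. *)
Lemma lebesgue_measure_translate (a : R) A : measurable A ->
  mu [set t | A (a + t)] = mu A.
Proof.
move=> mA; apply/esym.
rewrite (@lebesgue_measure_unique _
  (pushforward mu (fun t => a + t : measurableTypeR R)))//=.
  exact: measurable_translate.
move=> _ _ [[x y]] _ <-; rewrite /pushforward.
rewrite (_ : _ @^-1` _ = `]x - a, y - a]%classic); last first.
  by apply/seteqP; split=> t /=; rewrite !in_itv/= ltrBlDl lerBrDl.
rewrite /= !lebesgue_measure_itv /= !lte_fin ltrD2r.
by case: ifPn => // _; rewrite -!EFinB; congr EFin; ring.
Qed.

Lemma ge0_integral_translate (a : R) (D : set R) (h : R -> \bar R) :
  measurable D -> measurable_fun D h -> (forall t, D t -> 0 <= h t)%E ->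
  (\int[mu]_(t in [set t | D (a + t)%R]) h (a + t)%R = \int[mu]_(t in D) h t)%E.
Proof.
move=> mD mh h0.
transitivity (\int[pushforward mu (fun t => (a +
  t)%R : measurableTypeR R)]_(t in D) h t)%E.
  rewrite ge0_integral_pushforward//; first exact: measurable_translate.
  by move=> y; rewrite inE; exact: h0.
apply: eq_measure_integral => //; first exact: measurable_translate.
by move=> mf A mA _; exact: lebesgue_measure_translate.
Qed.

Lemma measurable_row_mx n : measurable_fun setT
  (fun p : measurableTypeR R * 'rV[R]_n => row_mx p.1%:M p.2 : 'rV[R]_n.+1).
Proof.
apply/measurable_fun_rVP => i; under eq_fun do rewrite mxE.
case: splitP => k _; last exact: (measurableT_comp (measurable_coord k)).
by rewrite (ord1 k); under eq_fun do rewrite mxE mulr1n; exact: measurable_fst.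
Qed.

Lemma measurable_fun_addrV d (T : measurableType d) n (g h : T -> 'rV[R]_n) :
  measurable_fun setT g -> measurable_fun setT h ->
  measurable_fun setT (fun w => g w + h w).
Proof.
move=> mg mh; apply/measurable_fun_rVP => i; under eq_fun do rewrite mxE.
by apply: measurable_funD; exact: (measurableT_comp (measurable_coord i)).
Qed.

Lemma measurable_addrV n (v : 'rV[R]_n) : measurable_fun setT (fun y => v + y).
Proof. by apply: measurable_fun_addrV => //; exact: measurable_cst. Qed.

(** Induction along the slices: each slice is translated by the tail of [v], which the induction
    hypothesis absorbs, and the slicing variable by the head, which is the one-dimensional case. *)
Lemma lebesgue_rV_translate n (v : 'rV[R]_n) (A : set 'rV[R]_n) :
  measurable A -> lebesgue_rV [set y | A (v + y)] = lebesgue_rV A.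
Proof.
elim: n v A => [|n IH] v A mA.
  by congr lebesgue_rV; apply/funext => y /=; congr (A _); apply/rowP => -[].
pose C (t : R) := [set w : 'rV[R]_n | A (row_mx t%:M w)].
pose S := (fun p : measurableTypeR R * 'rV[R]_n => row_mx p.1%:M p.2 :
  'rV[R]_n.+1) @^-1` A.
have mS : measurable S.
  by rewrite -[S]setTI; apply: measurable_row_mx.
have CE t : C t = xsection S t.
  by apply/seteqP; split=> w; rewrite /xsection/= inE.
have mC t : measurable (C t) by rewrite CE; exact: measurable_xsection.
pose v' : 'rV[R]_n := \row_j v ord0 (lift ord0 j).
rewrite /=.
transitivity (\int[mu]_t lebesgue_rV (C (v ord0 ord0 + t)%R))%E.
  apply: eq_integral => t _; rewrite -[RHS](IH v')//; congr lebesgue_rV.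
  apply/funext => w /=; congr (A _); apply/rowP => j; rewrite !mxE.
  case: splitP => k jk; rewrite !mxE.
    by rewrite (ord1 k) !mulr1n; congr (v _ _ + _); apply/val_inj;
      rewrite /= jk (ord1 k).
  by congr (v _ _ + _); apply/val_inj; rewrite /= jk.
transitivity (\int[mu]_t lebesgue_rV (C t))%E => //.
rewrite -[RHS](@ge0_integral_translate (v ord0 ord0))//.
rewrite (_ : (fun t => lebesgue_rV (C t)) = lebesgue_rV \o xsection S).
  exact: measurable_fun_xsection.
by apply/funext => t /=; rewrite CE.
Qed.

Lemma ge0_integral_rV_translate n (v : 'rV[R]_n) (h : 'rV[R]_n -> \bar R) :
  measurable_fun setT h -> (forall y, 0 <= h y)%E ->
  (\int[lebesgue_rV]_y h (v + y)%R = \int[lebesgue_rV]_y h y)%E.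
Proof.
move=> mh h0.
transitivity (\int[pushforward lebesgue_rV (fun y => (v + y)%R)]_y h y)%E.
  by rewrite ge0_integral_pushforward//; exact: measurable_addrV.
apply: eq_measure_integral => //; first exact: measurable_addrV.
by move=> mf A mA _; exact: lebesgue_rV_translate.
Qed.

End translation.

(* The square is split along its diagonal; the lower half is folded onto the
   upper one by Tonelli's theorem. *)
Lemma ge0_integral_sqrT (R : realType) (h : R -> \bar R) :
  measurable_fun setT h -> (forall t, 0 <= h t)%E ->
  ((\int[lebesgue_measure]_t h t) ^+ 2 =
   2%:E * \int[lebesgue_measure]_s
     (h s * \int[lebesgue_measure]_(t in `]s, +oo[) h t))%E.
Proof.
move=> mh h0; pose mu := @lebesgue_measure R.
pose K (D : set (measurableTypeR R * measurableTypeR R)) p :=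
  (h p.1 * (h p.2 * (\1_D p)%:E))%E.
have K0 D p : (0 <= K D p)%E by rewrite /K !mule_ge0// lee_fin.
have mK D : measurable D -> measurable_fun setT (K D).
  move=> mD; apply: emeasurable_funM; first exact: measurableT_comp mh _.
  apply: emeasurable_funM; first exact: measurableT_comp mh _.
  by apply/measurable_EFinP; exact: measurable_indic.
have KE D s : measurable D ->
    (\int[mu]_t K D (s, t) = h s * \int[mu]_(t in xsection D s) h t)%E.
  move=> mD; rewrite [in RHS]integral_mkcond -ge0_integralZl//.
  - apply: eq_integral => t _; rewrite /K/= indicE patchE mem_xsection.
    by case: ifPn => _; rewrite ?mule1 ?mule0.
  - apply/(measurable_restrictT h); first exact: measurable_xsection.
    exact: measurable_funS mh.
  - by move=> t _; rewrite patchE; case: ifPn.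
have KE' D t : measurable D ->
    (\int[mu]_s K D (s, t) = h t * \int[mu]_(s in ysection D t) h s)%E.
  move=> mD; rewrite [in RHS]integral_mkcond -ge0_integralZl//.
  - apply: eq_integral => s _; rewrite /K/= indicE patchE mem_ysection.
    by case: ifPn => _; rewrite ?mule1 ?mule0// muleC.
  - apply/(measurable_restrictT h); first exact: measurable_ysection.
    exact: measurable_funS mh.
  - by move=> s _; rewrite patchE; case: ifPn.
pose Lle := [set p : measurableTypeR R * measurableTypeR R | p.2 <= p.1].
pose Llt := [set p : measurableTypeR R * measurableTypeR R | p.1 < p.2].
have mLlt : measurable Llt.
  rewrite -[Llt]setTI; exact: (@measurable_fun_ltr _ _ _ _ _ _ measurable_fst
    measurable_snd measurableT [set true]).
have LleE : Lle = ~` Llt.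
  by rewrite /Lle /Llt; apply/seteqP; split=> p /=; rewrite leNgt => /negP.
have mLle : measurable Lle by rewrite LleE; exact: measurableC.
have xLlt s : xsection Llt s = `]s, +oo[%classic.
  by apply/seteqP; split=> t; rewrite /xsection/Llt/= inE/= in_itv/= andbT.
have yLle t : ysection Lle t = `[t, +oo[%classic.
  by apply/seteqP; split=> s; rewrite /ysection/Lle/= inE/= in_itv/= andbT.
rewrite expe2 -ge0_integralZr//; last exact: integral_ge0.
transitivity (\int[mu]_s (\int[mu]_t K Lle (s, t) + \int[mu]_t K Llt (s, t)))%E.
  apply: eq_integral => s _; rewrite -ge0_integralD//; last 2 first.
    by apply: measurableT_comp (mK _ mLle) _; exact: pair1_measurable.
    by apply: measurableT_comp (mK _ mLlt) _; exact: pair1_measurable.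
  rewrite -ge0_integralZl//; apply: eq_integral => t _; rewrite /K/= LleE.
  rewrite !indicE in_setC; case: (_ \in _) => /=.
    by rewrite !mule0 add0e mule1.
  by rewrite !mule0 adde0 mule1.
rewrite ge0_integralD//; last 4 first.
- by move=> s _; exact: integral_ge0.
- exact: (@measurable_fun_fubini_tonelli_F _ _ _ _ _ mu _ (mK _ mLle)).
- by move=> s _; exact: integral_ge0.
- exact: (@measurable_fun_fubini_tonelli_F _ _ _ _ _ mu _ (mK _ mLlt)).
rewrite fubini_tonelli//; last exact: mK.
rewrite mule_natl mule2n; congr (_ + _)%E; apply: eq_integral => s _.
  (* The diagonal was put into [Lle], so this section contains its left end, a null point. *)
  rewrite KE'// yLle -integral_itv_obnd_cbnd//.
  exact: measurable_funS mh.
by rewrite KE// xLlt.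
Qed.

Lemma ge0_integral_sqr (R : realType) (h : R -> \bar R) :
  measurable_fun setT h -> (forall t, 0 <= h t)%E ->
  ((\int[lebesgue_measure]_(t in `]0%R, +oo[) h t) ^+ 2 =
   2%:E * \int[lebesgue_measure]_(s in `]0%R, +oo[)
     (h s * \int[lebesgue_measure]_(t in `]s, +oo[) h t))%E.
Proof.
move=> mh h0; rewrite integral_mkcond ge0_integral_sqrT; last 2 first.
- apply/(measurable_restrictT h) => //; exact: measurable_funS mh.
- by move=> t; rewrite patchE; case: ifPn.
congr (_ * _)%E; rewrite [RHS]integral_mkcond; apply: eq_integral => s _.
rewrite !patchE; case: ifPn => [|_]; last by rewrite mul0e.
rewrite inE/= in_itv/= andbT => s0; congr (_ * _)%E.
apply: eq_integral => t; rewrite inE/= in_itv/= andbT => st.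
by rewrite patchE mem_set//= in_itv/= andbT (lt_trans s0).
Qed.

(** * Substitution t = c / u on the half-line *)

(** Carries a change of variables made on compact intervals over to the half-line. *)
Lemma ge0_integral_exhaust (R : realType) (A : nat -> set R) (G : R -> R) :
  nondecreasing_seq A -> (forall k, measurable (A k)) ->
  \bigcup_k A k = `]0, +oo[%classic ->
  measurable_fun `](0 : R), +oo[ G -> (forall t : R, 0 < t -> 0 <= G t) ->
  (\int[lebesgue_measure]_(t in A k) (G t)%:E @[k --> \oo] -->
   \int[lebesgue_measure]_(t in `]0%R, +oo[) (G t)%:E)%E.
Proof.
move=> ndA mA UA mG G0.
have sA k : A k `<=` `]0, +oo[ by rewrite -UA; exact: bigcup_sup.
rewrite -UA; apply: ge0_nondecreasing_set_cvg_integral => //.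
  by move=> k; apply/measurable_EFinP; exact: measurable_funS mG.
by move=> k t /sA; rewrite /= in_itv/= andbT lee_fin; exact: G0.
Qed.

Lemma pos_continuous_measurable (R : realType) (G : R -> R) :
  {in `]0, +oo[, continuous G} -> measurable_fun `](0 : R), +oo[ G.
Proof.
move=> cG; apply: open_continuous_measurable_fun; first exact: interval_open.
by move=> t; rewrite inE; exact: cG.
Qed.

(** The map u -> c / u is singular at 0 and exchanges the two ends of the half-line. It is used on
    [1/(k+1), k+1], with image [c/(k+1), c(k+1)]; both families exhaust the half-line. *)
Lemma ge0_integral_inv (R : realType) (c : R) (G : R -> R) : 0 < c ->
  {in `]0, +oo[, continuous G} -> (forall t : R, 0 < t -> 0 <= G t) ->
  (\int[lebesgue_measure]_(t in `]0%R, +oo[) (G t)%:E =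
   \int[lebesgue_measure]_(u in `]0%R, +oo[) (G (c / u) * (c / u ^+ 2))%:E)%E.
Proof.
move=> c0 cG G0; pose F u : R := c / u.
have dF (x : R) : x != 0 -> is_derive x 1 F (- (c / x ^+ 2)).
  move=> x0; rewrite (_ : - _ = c *: (- x ^- 2 *: 1)).
    by apply: is_deriveZ; exact: is_deriveV.
  by rewrite /GRing.scale/= mulr1 mulrN.
have cF (x : R) : x != 0 -> {for x, continuous F}.
  by move=> x0; apply: differentiable_continuous; apply/derivable1_diffP;
    case: (dF x x0).
have cdF (x : R) : 0 < x -> {for x, continuous (fun y : R => - (c / y ^+ 2))}.
  move=> x0; apply: cvgN; apply: cvgM; first exact: cvg_cst.
  by apply: cvgV; [rewrite expf_neq0// gt_eqF|exact: exprn_continuous].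
(* Valid on a neighbourhood, so that continuity of [derive1 F] can be read off from the explicit
   formula. *)
have F'E (x : R) : 0 < x -> \forall y \near x, derive1 F y = - (c / y ^+ 2).
  move=> x0; near=> y.
  have y0 : y != 0 by rewrite gt_eqF//; near: y; exact: lt_nbhsr.
  by rewrite derive1E; case: (dF y y0).
have cF' (x : R) : 0 < x -> {for x, continuous (derive1 F)}.
  move=> x0; suff : derive1 F y @[y --> x] --> derive1 F x by [].
  rewrite [X in _ --> X](nbhs_singleton (F'E x x0)).
  apply: cvg_trans (cdF x x0); apply: near_eq_cvg.
  by move: (F'E x x0); apply: filterS => y ->.
pose A k : set R := `[k.+1%:R^-1, k.+1%:R]%classic.
pose A' k : set R := `[c / k.+1%:R, c / k.+1%:R^-1]%classic.
have key k : (\int[lebesgue_measure]_(t in A' k) (G t)%:E =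
    \int[lebesgue_measure]_(u in A k) (G (c / u) * (c / u ^+ 2))%:E)%E.
  have k0 : 0 < k.+1%:R^-1 :> R by rewrite invr_gt0.
  have k1 : k.+1%:R^-1 <= k.+1%:R :> R.
    by rewrite (@le_trans _ _ 1)// ?invf_le1 ?ler1n.
  rewrite (@integration_by_substitution_decreasing _ F G _ _ k1).
  - apply: eq_integral => u; rewrite inE/= in_itv/= => /andP[u0 _].
    have u1 := lt_le_trans k0 u0.
    by rewrite /= fctE /= fctE (nbhs_singleton (F'E u u1)) opprK.
  - move=> x y; rewrite !in_itv/= => /andP[x0 _] /andP[y0 _] xy.
    by rewrite /F ltr_pM2l// ltf_pV2// posrE; exact: lt_le_trans k0 _.
  - move=> x; rewrite in_itv/= => /andP[x0 _]; apply: cF'.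
    exact: lt_trans k0 x0.
  - by apply/cvg_ex; eexists; apply: cvg_at_right_filter; exact: cF'.
  - by apply/cvg_ex; eexists; apply: cvg_at_left_filter; exact: cF'.
  - split.
    + move=> x; rewrite in_itv/= => /andP[x0 _].
      by have [] := dF x (lt0r_neq0 (lt_trans k0 x0)).
    + by apply: cvg_at_right_filter; apply: cF; exact: lt0r_neq0.
    + by apply: cvg_at_left_filter; apply: cF.
  - apply: continuous_in_subspaceT => x; rewrite inE/= in_itv/= => /andP[x0 _].
    by apply: cG; rewrite in_itv/= andbT (lt_le_trans _ x0)// divr_gt0.
(* Needed for e = c and for e = 1. A point x lies in the k-th interval when k + 1 exceeds both e / x
   and x / e, hence the maximum in the witness. *)
have exc (e : R) : 0 < e -> \bigcup_k `[e / k.+1%:R, e / k.+1%:R^-1]%classic =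
  `]0, +oo[%classic.
  move=> e0; apply/seteqP; split=> [x [k _]|x] /=; rewrite !in_itv/= andbT.
    by move=> /andP[+ _]; apply: lt_le_trans; rewrite divr_gt0.
  move=> x0; exists (Num.bound (Num.max (e / x) (x / e))) => //=.
  set b := Num.bound _.
  have /andP[b1 b2] : (e / x <= b.+1%:R) && (x / e <= b.+1%:R).
    have : Num.max (e / x) (x / e) <= b.+1%:R.
      rewrite (le_trans (ltW (archi_boundP _)))// ?ler_nat// le_max divr_ge0//
        ltW//.
    by rewrite ge_max.
  rewrite in_itv/=; rewrite ler_pdivrMr// mulrC -ler_pdivrMr// b1/=.
  by rewrite invrK -ler_pdivrMl// mulrC.
have nd (e : R) : 0 < e ->
    nondecreasing_seq (fun k => `[e / k.+1%:R, e / k.+1%:R^-1]%classic : set R).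
  move=> e0 k l kl; apply/subsetPset => x /=; rewrite !in_itv/= => /andP[xk kx].
  apply/andP; split.
    by apply: le_trans xk; rewrite ler_pM2l// lef_pV2 ?posrE// ler_nat ltnS;
      exact: kl.
  by apply: (le_trans kx); rewrite ler_pM2l// !invrK ler_nat ltnS; exact: kl.
have AE : A = (fun k => `[1 / k.+1%:R, 1 / k.+1%:R^-1]%classic).
  by apply/funext => k; rewrite /A !div1r invrK.
have L1 :=
  @ge0_integral_exhaust R A' G (nd c c0) (fun=> measurable_itv _) (exc c c0)
  (pos_continuous_measurable cG) G0.
have L2 := @ge0_integral_exhaust R A (fun u => G (c / u) * (c / u ^+ 2)).
rewrite -(cvg_lim _ L1)// (eq_fun key); apply: cvg_lim => //; apply: L2.
- by rewrite AE; exact: nd.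
- by move=> k; exact: measurable_itv.
- by rewrite AE; exact: exc.
- apply: pos_continuous_measurable => u; rewrite in_itv/= andbT => u0.
  apply: cvgM.
    apply: (@continuous_comp _ _ _ F G).
      by apply: cF; exact: lt0r_neq0.
    by apply: cG; rewrite in_itv/= andbT divr_gt0.
  apply: cvgM; first exact: cvg_cst.
  by apply: cvgV; [rewrite expf_neq0// gt_eqF|exact: exprn_continuous].
- move=> u u0; rewrite mulr_ge0//; first by rewrite G0// divr_gt0.
  by rewrite divr_ge0 ?exprn_ge0// ltW.
Unshelve. all: by end_near. Qed.

(** * The heat kernel and its integral over time *)

(** Inversion is discontinuous at 0. The factor x in front of a measurable power of x^2 gives the
    right sign for x < 0 and the value 0 at x = 0. *)
Lemma measurable_invr (R : realType) : measurable_fun setT (@GRing.inv R).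
Proof.
rewrite (_ : @GRing.inv R = fun x => x * (x ^+ 2) `^ (-1)); last first.
  apply/funext => x; rewrite powR_inv1 ?sqr_ge0//.
  have [->|x0] := eqVneq x 0; first by rewrite invr0 mul0r.
  by rewrite expr2 invfM mulrA divff// mul1r.
apply: measurable_funM => //.
by apply: (measurableT_comp (measurable_powR (-1))); exact: measurable_funX.
Qed.

Lemma measurable_sqrtr (R : realType) : measurable_fun setT (@Num.sqrt R).
Proof. by apply: continuous_measurable_fun; exact: sqrt_continuous. Qed.

Section heat_kernel_theory.
Context (R : realType) (n : nat).
Implicit Types (y : 'rV[R]_n) (t : R).

Lemma enorm_ge0 y : 0 <= enorm y.
Proof. exact: sqrtr_ge0. Qed.

Lemma enorm_gt0 y : y != 0 -> 0 < enorm y.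
Proof.
move=> y0; rewrite sqrtr_gt0 lt_neqAle sumr_ge0 ?andbT; last first.
  by move=> i _; exact: sqr_ge0.
apply: contraNneq y0 => /esym/eqP; rewrite psumr_eq0; last first.
  by move=> i _; exact: sqr_ge0.
move=> /allP/= y0; apply/eqP/rowP => i; rewrite mxE.
by apply/eqP; rewrite -sqrf_eq0; apply: y0; rewrite mem_index_enum.
Qed.

Lemma measurable_enorm : measurable_fun setT (@enorm R n).
Proof.
apply: (measurableT_comp (@measurable_sqrtr R)).
by apply: measurable_sum => i; apply: measurable_funX; exact: measurable_coord.
Qed.

Lemma measurable_enorm_exprV k :
  measurable_fun setT (fun y : 'rV[R]_n => (enorm y ^+ k)^-1).
Proof.
apply: (measurableT_comp (@measurable_invr R)).
exact: (measurable_funX _ measurable_enorm).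
Qed.

Lemma enorm_exprV_ge0 k y : 0 <= (enorm y ^+ k)^-1.
Proof. by rewrite invr_ge0 exprn_ge0// enorm_ge0. Qed.

Lemma heat_kernel_ge0 t y : 0 <= heat_kernel t y.
Proof. by rewrite mulr_ge0 ?powR_ge0 ?expR_ge0. Qed.

Lemma heat_kernel_gt0 t y : 0 < t -> 0 < heat_kernel t y.
Proof. by move=> t0;
  rewrite mulr_gt0 ?expR_gt0// powR_gt0// !mulr_gt0 ?pi_gt0. Qed.

Lemma measurable_heat_kernel2 : measurable_fun setT
  (fun p : measurableTypeR R * 'rV[R]_n => heat_kernel p.1 p.2).
Proof.
apply: measurable_funM.
  apply: (measurableT_comp (measurable_powR _)).
  by apply: measurable_funM => //; exact: measurable_cst.
apply: (measurableT_comp (@measurable_expR R)).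
apply: measurable_funN; apply: measurable_funM.
  by apply: measurable_funX; exact: (measurableT_comp measurable_enorm).
apply: (measurableT_comp (@measurable_invr R)).
by apply: measurable_funM => //; exact: measurable_cst.
Qed.

Lemma measurable_heat_kernel t : measurable_fun setT (@heat_kernel R n t).
Proof.
exact: (measurableT_comp measurable_heat_kernel2 (pair1_measurable (t :
  measurableTypeR R))).
Qed.

Lemma heat_kernel_le t y : 0 < t ->
  heat_kernel t y <= (2 * pi * t) `^ (- (n%:R / 2)).
Proof.
move=> t0; rewrite ler_piMr ?powR_ge0// -expR0 ler_expR oppr_le0.
by rewrite divr_ge0 ?sqr_ge0// mulr_ge0// ltW.
Qed.

Lemma continuous_powR (a : R) : {in `]0, +oo[,
  continuous (fun t : R => t `^ a)}.
Proof.
move=> t; rewrite in_itv/= andbT => t0; apply: differentiable_continuous.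
apply/derivable1_diffP; by have [] := @is_derive1_powR R a t t0.
Qed.

(** Equal to 1 / (2 pi^(n/2)). Times Gamma(n/2 - 1) it is the coefficient of |y|^(2-n) in the Green
    function of Brownian motion; the Gamma factor is kept apart as long as it is not known to be
    finite. *)
Definition green_const : R := 2 `^ (n%:R / 2 - 1) / (2 * pi) `^ (n%:R / 2).

Lemma green_const_ge0 : 0 <= green_const.
Proof. by rewrite divr_ge0// powR_ge0. Qed.

(** With t = |y|^2 / (2u) the Gaussian exponent becomes -u, and t^(-n/2) dt contributes u^(n/2 - 2).
    The bound on [n] keeps the subtraction [n - 2] exact. *)
Lemma integral_heat_kernel y : (2 <= n)%N -> y != 0 ->
  (\int[lebesgue_measure]_(t in `]0%R, +oo[) (heat_kernel t y)%:E =
   (green_const / enorm y ^+ (n - 2))%:E *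
   \int[lebesgue_measure]_(t in `]0%R, +oo[)
     (t `^ (n%:R / 2 - 1 - 1) * expR (- t))%:E)%E.
Proof.
move=> n2 y0; have r0 := enorm_gt0 y0; set r := enorm y in r0 *.
have c0 : 0 < r ^+ 2 / 2 by rewrite divr_gt0// exprn_gt0.
rewrite (ge0_integral_inv c0); last 2 first.
- move=> t; rewrite in_itv/= andbT => t0.
  apply: cvgM.
    apply: (@continuous_comp _ _ _ (fun t => 2 * pi * t)
      (fun t => t `^ (- (n%:R / 2)))); first exact: mulrl_continuous.
    by apply: continuous_powR; rewrite in_itv/= andbT !mulr_gt0// pi_gt0.
  apply: (@continuous_comp _ _ _ (fun t => - (r ^+ 2 / (2 * t))) expR).
    apply: cvgN; apply: cvgM; first exact: cvg_cst.
    by apply: cvgV; [rewrite mulf_neq0// gt_eqF|exact: mulrl_continuous].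
  exact: continuous_expR.
- by move=> t _; exact: heat_kernel_ge0.
rewrite -ge0_integralZl//; last 3 first.
- apply/measurable_EFinP; apply: measurable_funM.
    apply: pos_continuous_measurable; exact: continuous_powR.
  by apply: measurable_funTS; apply: (measurableT_comp (@measurable_expR R)).
- by move=> t _; rewrite lee_fin mulr_ge0 ?powR_ge0 ?expR_ge0.
- by rewrite lee_fin mulr_ge0 ?green_const_ge0 ?enorm_exprV_ge0.
apply: eq_integral => u; rewrite inE/= in_itv/= andbT => u0.
rewrite -EFinM; congr EFin; rewrite /heat_kernel -/r.
have u0' : u != 0 by rewrite gt_eqF.
have rn0 : r != 0 by rewrite gt_eqF.
have pn0 : pi != 0 :> R by rewrite gt_eqF// pi_gt0.
have -> : - (r ^+ 2 / (2 * (r ^+ 2 / 2 / u))) = - u by field; rewrite u0' rn0.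
have -> : 2 * pi * (r ^+ 2 / 2 / u) = pi * r ^+ 2 / u by field.
rewrite [RHS]mulrA mulrAC; congr (_ * _).
(* Real powers are split until both sides share the same powers of u, |y|, pi and 2, which [field]
   then treats as atoms. *)
rewrite powRM ?invr_ge0 ?(ltW u0)//; last by rewrite mulr_ge0 ?sqr_ge0 ?pi_ge0.
rewrite powRM ?pi_ge0 ?sqr_ge0//.
have -> : u^-1 `^ (- (n%:R / 2)) = u `^ (n%:R / 2).
  by rewrite -powR_inv1 ?(ltW u0)// -powRrM mulN1r opprK.
have -> : (r ^+ 2) `^ (- (n%:R / 2)) = (r ^+ (n - 2) * r ^+ 2)^-1.
  rewrite -exprD subnK// powRN -powR_mulrn ?(ltW r0)// -powRrM mulrCA divff//
    mulr1.
  by rewrite powR_mulrn// ltW.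
rewrite (_ : n%:R / 2 - 1 - 1 = n%:R / 2 - 2%:R); last by ring.
rewrite powRB ?u0' ?implybT// powR_mulrn ?(ltW u0)//.
rewrite /green_const powRB ?pnatr_eq0 ?implybT// powRr1//.
rewrite (powRM _ _ (pi_ge0 R))// powRN.
have p2 : 2 `^ (n%:R / 2) != 0 :> R by rewrite gt_eqF// powR_gt0.
have pp : pi `^ (n%:R / 2) != 0 :> R by rewrite gt_eqF// powR_gt0// pi_gt0.
have rr : r ^+ (n - 2) != 0 by rewrite expf_neq0.
field.
by rewrite p2 pp rr u0' rn0.
Qed.

End heat_kernel_theory.

(** * Boundedness of potentials *)

Section boxes.
Context (R : realType) (n : nat).

Lemma measurable_box (A : 'I_n -> set (measurableTypeR R)) :
  (forall i, measurable (A i)) ->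
  measurable [set v : 'rV[R]_n | forall i, A i (v ord0 i)].
Proof.
move=> mA; rewrite (_ : [set v | _] =
    \bigcap_(i in [set: 'I_n]) (fun v : 'rV[R]_n => v ord0 i) @^-1` A i).
  apply: fin_bigcap_measurable => // i _.
  by rewrite -[X in measurable X]setTI; exact: measurable_coord (mA i).
by apply/seteqP; split=> [v vA i _|v vA i]; [exact: vA|exact: (vA i Logic.I)].
Qed.

(** The origin is a box with null sides. In dimension 0 it carries the whole mass, hence the
    hypothesis. *)
Lemma ae_neq0 : (0 < n)%N -> {ae lebesgue_rV, forall y : 'rV[R]_n, y != 0}.
Proof.
move=> n0; exists [set v : 'rV[R]_n | forall i, [set 0] (v ord0 i)]; split.
- by apply: (@measurable_box (fun=> [set 0])) => i; exact: measurable_set1.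
- rewrite (@lebesgue_rV_box R n (fun=> [set 0])); last by move=> i;
  exact: measurable_set1.
  by rewrite (bigD1 (Ordinal n0))//= lebesgue_measure_set1 mul0e.
- by move=> y /= /negP; rewrite negbK => /eqP -> i; rewrite mxE.
Qed.

End boxes.

(** The exponent is the decay of the heat kernel in dimension 3, the slowest one allowed; an
    antiderivative is -2 t^(-1/2), which vanishes at infinity. *)
Lemma integral_powRN_ge1 (R : realType) :
  (\int[lebesgue_measure]_(t in `]1%R, +oo[)
    (t `^ (- (3 / 2) : R))%:E <= 2%:E)%E.
Proof.
have c t : 0 < t -> {for t, continuous (fun t : R => t `^ (- (3 / 2)))}.
  by move=> t0; apply: continuous_powR; rewrite in_itv/= andbT.
have c' t : 0 < t -> {for t, continuous (fun t : R => -2 * t `^ (- 2^-1))}.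
  move=> t0; apply: cvgM; first exact: cvg_cst.
  by apply: continuous_powR; rewrite in_itv/= andbT.
have dF (t : R) : 0 < t ->
  is_derive t 1 (fun t : R => -2 * t `^ (- 2^-1)) (t `^ (- (3 / 2))).
  move=> t0; have H := is_derive1_powR (- 2^-1) t0.
  rewrite (_ : _ `^ _ = -2 *: (- 2^-1 * t `^ (- 2^-1 - 1)));
    first exact: is_deriveZ.
  rewrite /GRing.scale/= mulrA mulrNN divff ?pnatr_eq0// mul1r; congr (_ `^ _).
  by field.
rewrite integral_itv_obnd_cbnd; last first.
  apply/measurable_EFinP;
    apply: measurable_funS (pos_continuous_measurable (@continuous_powR R _)) =>
    //.
  by move=> t /=; rewrite !in_itv/= !andbT; apply: lt_trans.
rewrite (@ge0_continuous_FTC2y _ _ (fun t => -2 * t `^ (- 2^-1)) 1 0).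
- by rewrite powR1 mulr1 sub0e -EFinN opprK.
- by move=> t _; exact: powR_ge0.
- apply: continuous_in_subspaceT => t; rewrite inE/= in_itv/= andbT => t1.
  exact/c/(lt_le_trans _ t1).
- rewrite -[X in _ --> X](mulr0 (-2)); apply: cvgM; first exact: cvg_cst.
  under eq_fun do rewrite powRN.
  apply/gtr0_cvgV0.
    by near=> t; apply: powR_gt0; near: t; apply: nbhs_pinfty_gt;
      rewrite num_real.
  apply/cvgryPge => A; near=> t.
  have At : A ^+ 2 <= t by near: t; apply: nbhs_pinfty_ge; rewrite num_real.
  rewrite powR12_sqrt ?(le_trans (sqr_ge0 A))//.
  by rewrite (le_trans (ler_norm A))// -sqrtr_sqr ler_wsqrtr//.
- move=> t t1; have H := dF t (lt_trans ltr01 t1); by have [] := H.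
- by apply: cvg_at_right_filter; exact: c'.
- move=> t; rewrite in_itv/= andbT => t1; rewrite derive1E.
  by have [] := dF t (lt_trans ltr01 t1).
Unshelve. all: by end_near. Qed.

(** Source of all strict positivity below: of the Gamma integral, of the weighted integral over the
    cube, of the expectation of f. The last hypothesis is only almost sure, so that the origin,
    where division yields 0, can be left out. *)
Lemma ge0_integral_eq0_measure0 d (T : measurableType d) (R : realType)
    (mu : {measure set T -> \bar R}) (D A : set T) (f : T -> \bar R) :
  measurable D -> measurable A -> A `<=` D -> measurable_fun D f ->
  (forall x, D x -> 0 <= f x)%E -> (\int[mu]_(x in D) f x = 0)%E ->
  {ae mu, forall x, A x -> f x != 0} -> mu A = 0.
Proof.
move=> mD mA AD mf f0 If fA.
have fae : ae_eq mu D f (cst 0%E).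
  apply/ae_eq_integral_abs => //; rewrite -If; apply: eq_integral => x.
  by rewrite inE => /f0 fx; rewrite gee0_abs.
have : {ae mu, forall x, ~ A x}.
  by move: fae fA; apply: filterS2 => x fx0 fxA Ax; move: (fxA Ax);
    rewrite fx0 ?eqxx//; exact: AD.
move=> nA; apply: measure_negligible => //.
by apply: negligibleS nA => x Ax /(_ Ax).
Qed.

Section potential.
Context (R : realType) (n : nat).
Local Open Scope ereal_scope.

(** Written with the heat kernel instead of a process: it is needed at every [v], whereas the given
    motion starts from one point. Extended values of [h] allow the potential of f times a
    potential. *)
Definition potential (h : 'rV[R]_n -> \bar R) (v : 'rV[R]_n) : \bar R :=
  \int[lebesgue_measure]_(t in `]0%R, +oo[) \int[lebesgue_rV]_y
    (h (v + y)%R * (heat_kernel t y)%:E).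

(** Gamma(n/2 - 1) before it is known to be finite; the real-valued [Gamma] would silently be 0 if
    the integral diverged. *)
Definition gamma_integral : \bar R := \int[lebesgue_measure]_(t in `]0%R, +oo[)
  (t `^ (n%:R / 2 - 1 - 1) * expR (- t))%:E.

Lemma potential_ge0 h v : (forall y, 0 <= h y) -> 0 <= potential h v.
Proof.
move=> h0; apply: integral_ge0 => t _; apply: integral_ge0 => y _.
by rewrite mule_ge0// lee_fin heat_kernel_ge0.
Qed.

Lemma measurable_heat_shift (h : 'rV[R]_n ->
  \bar R) v : measurable_fun setT h ->
  measurable_fun setT (fun p : measurableTypeR R * 'rV[R]_n =>
    h (v + p.2)%R * (heat_kernel p.1 p.2)%:E).
Proof.
move=> mh; apply: emeasurable_funM.
  apply: (measurableT_comp mh).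
  exact: (measurableT_comp (measurable_addrV v) measurable_snd).
by apply/measurable_EFinP; exact: measurable_heat_kernel2.
Qed.

Lemma measurable_green : measurable_fun setT
  (fun y : 'rV[R]_n => (green_const R n / enorm y ^+ (n - 2))%:E).
Proof.
apply/measurable_EFinP; apply: measurable_funM => //.
exact: measurable_enorm_exprV.
Qed.

(* At y = 0 the heat kernel integrates to +oo whereas the division gives 0. *)
Lemma potentialE h v : (2 <= n)%N -> measurable_fun setT h ->
    (forall y, 0 <= h y) ->
  potential h v = gamma_integral * \int[lebesgue_rV]_y
    (h (v + y)%R * (green_const R n / enorm y ^+ (n - 2))%:E).
Proof.
move=> n2 mh h0.
have gamma0 : 0 <= gamma_integral.
  by apply: integral_ge0 => t _; rewrite lee_fin mulr_ge0 ?powR_ge0 ?expR_ge0.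
have g0 (y : 'rV[R]_n) : (0 <= green_const R n / enorm y ^+ (n - 2))%R.
  by rewrite mulr_ge0 ?green_const_ge0 ?enorm_exprV_ge0.
have mg : measurable_fun setT
    (fun y : 'rV[R]_n => (h (v +
      y)%R * (green_const R n / enorm y ^+ (n - 2))%:E)).
  apply: emeasurable_funM;
    first exact: (measurableT_comp mh (measurable_addrV v)).
  exact: measurable_green.
rewrite /potential.
have mH := measurable_heat_shift v mh.
have H0 (p : measurableTypeR R * 'rV[R]_n) :
    0 <= h (v + p.2)%R * (heat_kernel p.1 p.2)%:E.
  by rewrite mule_ge0// lee_fin heat_kernel_ge0.
rewrite (@tonelli_in _ _ _ _ _ (@lebesgue_measure R) lebesgue_rV _ _ _ mH H0)//.
rewrite -ge0_integralZl//; last by move=> y _; rewrite mule_ge0// lee_fin.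
apply: ge0_ae_eq_integral => //.
- exact: (measurable_fun_integral_in lebesgue_measure (measurable_itv _) mH H0).
- exact: emeasurable_funM.
- by move=> y _; apply: integral_ge0 => t _; exact: (H0 (t, y)).
- by move=> y _; rewrite mule_ge0// mule_ge0// lee_fin.
have := @ae_neq0 R n (ltnW n2); apply: filterS => y y0 _.
rewrite /= (@ge0_integralZl _ _ _ (@lebesgue_measure R) _ (measurable_itv _)
  (fun t => (heat_kernel t y)%:E))//=; last 2 first.
- apply/measurable_EFinP; apply: measurable_funTS.
  exact: (measurableT_comp (@measurable_heat_kernel2 R n) (pair2_measurable y)).
- by move=> t _; rewrite lee_fin heat_kernel_ge0.
by rewrite integral_heat_kernel// -/gamma_integral (muleC _ gamma_integral)
  muleCA.
Qed.

(** Discharged by [heat_kernel_mass] once a Brownian motion is available. *)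
Hypothesis heat_mass : forall t : R, (0 < t)%R ->
  \int[lebesgue_rV]_y (heat_kernel t (y : 'rV[R]_n))%:E = 1.

(** The bound does not depend on [v]. It serves for the unit cube, for f, and for f times its
    potential; the 2 is the integral of t^(-3/2) over ]1, +oo[. *)
Lemma potential_le (h : 'rV[R]_n -> \bar R) (M : R) v : (3 <= n)%N ->
    measurable_fun setT h -> (forall y, 0 <= h y) -> (forall y, h y <= M%:E) ->
  potential h v <= M%:E + 2%:E * \int[lebesgue_rV]_y h y.
Proof.
move=> n3 mh h0 hM.
have mH := measurable_heat_shift v mh.
have H0 t y : 0 <= h (v + y)%R * (heat_kernel t y)%:E.
  by rewrite mule_ge0// lee_fin heat_kernel_ge0.
have mI : measurable_fun setT (fun t : measurableTypeR R =>
    \int[lebesgue_rV]_y (h (v + y)%R * (heat_kernel t y)%:E)).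
  by apply: (@measurable_fun_fubini_tonelli_F _ _ _ _ _ lebesgue_rV _ mH) => p.
have M0 : (0 <= M)%R by rewrite -lee_fin; exact: le_trans (h0 0%R) (hM 0%R).
have N0 : 0 <= \int[lebesgue_rV]_y h y by exact: integral_ge0.
have mhv : measurable_fun setT (fun y => h (v + y)%R).
  exact: (measurableT_comp mh (measurable_addrV v)).
have mp t : measurable_fun setT (fun y : 'rV[R]_n => (heat_kernel t y)%:E).
  by apply/measurable_EFinP; exact: measurable_heat_kernel.
have mhp t := emeasurable_funM mhv (mp t).
rewrite /potential (_ : `]0%R, +oo[%classic = `]0%R, 1%R] `|` `]1%R, +oo[);
  last first.
  by apply: (@itv_bndbnd_setU _ _ _ (BRight 1%R)); rewrite ?bnd_simp ?ler01.
rewrite ge0_integral_setU//=; last 3 first.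
- exact: measurable_funTS.
- by move=> t _; exact: integral_ge0.
- apply/disj_set2P; apply/seteqP; split=> // t [] /=; rewrite !in_itv/= andbT.
  by move=> /andP[_ t1] /(le_lt_trans t1); rewrite ltxx.
apply: leeD.
  apply: (@le_trans _ _ (\int[lebesgue_measure]_(t in `]0%R, 1%R]) cst M%:E t));
    last first.
    by rewrite integral_cst//= lebesgue_measure_itv/= lte_fin ltr01 oppr0 adde0
      mule1.
  apply: ge0_le_integral => //.
  - by move=> t _; exact: integral_ge0.
  - exact: measurable_funTS.
  move=> t /=; rewrite in_itv/= => /andP[t0 _].
  (* M is rewritten as M times the mass of the kernel, and the integrands are compared. *)
  rewrite -[leRHS]mule1 -(heat_mass t0) -ge0_integralZl//; last first.
    by move=> y _; rewrite lee_fin heat_kernel_ge0.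
  apply: ge0_le_integral => //.
  - exact: measurable_funeM.
  - by move=> y _; rewrite lee_wpmul2r// lee_fin heat_kernel_ge0.
apply: (@le_trans _ _ (\int[lebesgue_measure]_(t in `]1%R, +oo[)
    ((t `^ (- (3 / 2) : R))%:E * \int[lebesgue_rV]_y h y))).
  apply: ge0_le_integral => //.
  - by move=> t _; exact: integral_ge0.
  - exact: measurable_funTS.
  - apply: emeasurable_funM => //; apply/measurable_EFinP.
    by apply: measurable_funTS; exact: measurable_powR.
  move=> t /=; rewrite in_itv/= andbT => t1.
  have t0 : (0 < t)%R by exact: lt_trans t1.
  (* Translation invariance is what makes the bound uniform in [v]. *)
  rewrite -(ge0_integral_rV_translate v mh h0) -ge0_integralZl//; last first.
    by rewrite lee_fin powR_ge0.
  apply: ge0_le_integral => //.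
  - exact: measurable_funeM.
  move=> y _; rewrite muleC lee_wpmul2r// lee_fin.
  apply: (le_trans (heat_kernel_le y t0)).
  (* First 2 pi >= 1 is dropped from the base, then t > 1 and n >= 3 give t^(-n/2) <= t^(-3/2). *)
  apply: (@le_trans _ _ (t `^ (- (n%:R / 2)))%R).
    rewrite !powRN lef_pV2 ?posrE ?powR_gt0// ?mulr_gt0 ?pi_gt0//.
    rewrite ge0_ler_powR ?nnegrE ?divr_ge0// ?mulr_ge0 ?pi_ge0 ?(ltW t0)//.
    rewrite ler_peMl ?(ltW t0)//.
    by have := pi_ge2 R; lra.
  apply: ler_powR; first exact: ltW.
  by rewrite lerN2 ler_pM2r// ler_nat.
rewrite ge0_integralZr//; last 2 first.
  by apply/measurable_EFinP/measurable_funTS; exact: measurable_powR.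
  by move=> t _; rewrite lee_fin powR_ge0.
by apply: lee_wpmul2r => //; exact: integral_powRN_ge1.
Qed.

(* Otherwise the potential of the unit cube would be infinite. *)
Lemma gamma_integral_lty : (3 <= n)%N -> gamma_integral < +oo.
Proof.
move=> n3.
pose D : set 'rV[R]_n := [set v | forall i, `[0%R, 1%R]%classic (v ord0 i)].
have mD : measurable D.
  by apply: (@measurable_box R n (fun=> `[0%R, 1%R]%classic)).
have D1 : lebesgue_rV D = 1.
  rewrite (@lebesgue_rV_box R n (fun=> `[0%R, 1%R]%classic))// big1// => i _.
  by rewrite lebesgue_measure_itv/= lte_fin ltr01 oppr0 adde0.
pose h (y : 'rV[R]_n) : \bar R := (\1_D y)%:E.
have mh : measurable_fun setT h by apply/measurable_EFinP;
  exact: measurable_indic.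
have h0 y : 0 <= h y by rewrite lee_fin.
have h1 y : h y <= 1%:E by rewrite lee_fin indicE; case: (_ \in _).
have := @potential_le h 1 0%R n3 mh h0 h1.
have hE : \int[lebesgue_rV]_y h y = 1 by rewrite integral_indic// setIT;
  exact: D1.
rewrite hE mule1 (potentialE _ (ltnW n3) mh h0).
set J := \int[_]_y _ => le3.
have J0 : 0 < J.
  rewrite lt_neqAle integral_ge0 ?andbT; last first.
    move=> y _; rewrite mule_ge0// lee_fin.
    by rewrite mulr_ge0 ?green_const_ge0 ?enorm_exprV_ge0.
  apply/eqP => /esym J0.
  have : lebesgue_rV D = 0.
    apply: (@ge0_integral_eq0_measure0 _ _ _ _ setT _ _ _ _ _ _ _ J0) => //.
    - apply: emeasurable_funM;
      first exact: (measurableT_comp mh (measurable_addrV 0%R)).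
      exact: measurable_green.
    - move=> y _; rewrite mule_ge0// lee_fin.
      by rewrite mulr_ge0 ?green_const_ge0 ?enorm_exprV_ge0.
    - have := @ae_neq0 R n (ltnW (ltnW n3)); apply: filterS => y y0 Dy.
      rewrite add0r /h indicE mem_set// mul1e eqe mulf_neq0//.
        by rewrite mulf_neq0 ?invr_eq0 ?gt_eqF// powR_gt0// mulr_gt0// pi_gt0.
      by rewrite invr_eq0 expf_neq0// gt_eqF// enorm_gt0.
  by rewrite D1 => -[] /eqP; rewrite oner_eq0.
rewrite ltNge; apply/negP; rewrite leye_eq => /eqP goo.
by move: le3; rewrite goo gt0_mulye.
Qed.

Lemma gamma_integral_gt0 : 0 < gamma_integral.
Proof.
rewrite lt_neqAle integral_ge0 ?andbT; last first.
  by move=> t _; rewrite lee_fin mulr_ge0 ?powR_ge0 ?expR_ge0.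
apply/eqP => /esym g0.
have : lebesgue_measure (`]0%R, +oo[%classic : set R) = 0.
  apply: (@ge0_integral_eq0_measure0 _ _ _ _ _ _ _ _ _ _ _ _ g0) => //.
  - apply/measurable_EFinP; apply: measurable_funTS; apply: measurable_funM.
      exact: measurable_powR.
    exact: (measurableT_comp (@measurable_expR R)).
  - by move=> t _; rewrite lee_fin mulr_ge0 ?powR_ge0 ?expR_ge0.
  - apply: aeW => t /=; rewrite in_itv/= andbT => t0.
    by rewrite eqe gt_eqF// mulr_gt0 ?expR_gt0// powR_gt0.
by rewrite lebesgue_measure_itv/= ltry.
Qed.

End potential.

(** * Laws of Brownian motion *)

Section brownian_laws.
Context (R : realType) (n : nat) dT (T : measurableType dT)
  (P : probability T R) (x : 'rV[R]_n) (B : R -> T -> 'rV[R]_n)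
  (hB : brownian_motion P x B).
Local Open Scope ereal_scope.

(* B is only constrained at times t >= 0, hence the extension of its paths by
   B 0 to negative times. *)
Lemma measurable_path_eval (f : 'rV[R]_n -> R) : continuous f ->
  measurable_fun setT
    (fun p : measurableTypeR R * T => f (B (Num.max 0%R p.1) p.2)).
Proof.
move=> cf; pose G (t : R) w := f (B (Num.max 0%R t) w).
apply: (@measurable_fun_uncurry_continuous _ _ _ G) => [t|w t].
  apply: (measurableT_comp (continuous_rV_measurable cf)).
  by apply: (bm_measurable hB); rewrite le_max lexx.
apply: continuous_comp; last exact: cf.
have /(_ (Num.max 0%R t)) :=
  (subspace_continuousP _ _).1 (bm_continuous hB (w := w)).
rewrite /= in_itv/= le_max lexx => /(_ isT) cB.
have cm : {for t, continuous (fun t : R => Num.max 0%R t)}.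
  by apply: (@continuous_max _ _ (cst 0%R) id); [exact: cvg_cst|exact: cvg_id].
apply: (@cvg_comp _ _ _ (fun t : R => Num.max 0%R t) (B ^~ w) _
  (within [set` `[0%R, +oo[] (nbhs (Num.max 0%R t)))) => //.
move=> A wA.
have cmA : \forall s \near t,
    (Num.max 0%R s \in `[0%R, +oo[) -> A (Num.max 0%R s).
  exact: (cm [set z | z \in `[0%R, +oo[ -> A z] wA).
suff : \forall s \near t, A (Num.max 0%R s) by [].
apply: filterS cmA => s; apply.
by rewrite in_itv/= le_max lexx.
Qed.

Lemma measurable_path (f : 'rV[R]_n -> R) w : continuous f ->
  measurable_fun setT
    (fun t : measurableTypeR R => f (B (Num.max 0%R t) w)).
Proof.
by move=> cf;
  exact: (measurableT_comp (measurable_path_eval cf) (pair2_measurable w)).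
Qed.

(** No Gaussian integral is computed: the kernel is the density of B_t - B_0, so its integral is the
    probability of the sure event. *)
Lemma heat_kernel_mass (t : R) : (0 < t)%R ->
  \int[lebesgue_rV]_y (heat_kernel t (y : 'rV[R]_n))%:E = 1.
Proof.
move=> t0; have := bm_density hB (lexx 0%R) t0 measurableT.
rewrite subr0 => <-; exact: probability_setT.
Qed.

Lemma measurable_increment s t : (0 <= s)%R -> (0 <= t)%R ->
  measurable_fun setT (fun w => B t w - B s w)%R.
Proof.
move=> s0 t0; apply/measurable_fun_rVP => i; under eq_fun do rewrite !mxE.
apply: measurable_funB.
  exact: (measurableT_comp (measurable_coord i) (bm_measurable hB t0)).
exact: (measurableT_comp (measurable_coord i) (bm_measurable hB s0)).
Qed.

Lemma integral_increment s t (h : 'rV[R]_n -> \bar R) :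
  (0 <= s)%R -> (s < t)%R -> measurable_fun setT h -> (forall y, 0 <= h y) ->
  \int[P]_w h (B t w - B s w)%R =
  \int[lebesgue_rV]_y (h y * (heat_kernel (t - s) y)%:E).
Proof.
move=> s0 st mh h0.
have mI := measurable_increment s0 (ltW (le_lt_trans s0 st)).
transitivity (\int[pushforward P (fun w => (B t w - B s w)%R)]_y h y).
  by rewrite ge0_integral_pushforward.
apply: ge0_integral_density => //; first exact: measurable_heat_kernel.
  by move=> y; exact: heat_kernel_ge0.
by move=> A mA; exact: (bm_density hB s0 st mA).
Qed.

Lemma integral_bm t (h : 'rV[R]_n -> \bar R) :
  (0 < t)%R -> measurable_fun setT h -> (forall y, 0 <= h y) ->
  \int[P]_w h (B t w) =
  \int[lebesgue_rV]_y (h (x + y)%R * (heat_kernel t y)%:E).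
Proof.
move=> t0 mh h0.
rewrite -[in RHS](subr0 t) -(@integral_increment 0%R t (fun y => h (x +
  y)%R))//.
  by apply: eq_integral => w _; rewrite (bm_start hB) addrC subrK.
exact: (measurableT_comp mh (measurable_addrV x)).
Qed.

(** B_s and B_(s+u) are recovered from x and the increments over [0, s] and [s, s+u]. Independence
    identifies the joint law of these increments with a product on rectangles, hence everywhere. *)
Lemma integral_bm2 s u (h : 'rV[R]_n * 'rV[R]_n -> \bar R) :
  (0 < s)%R -> (0 < u)%R -> measurable_fun setT h -> (forall p, 0 <= h p) ->
  \int[P]_w h (B s w, B (s + u)%R w) =
  \int[lebesgue_rV]_y ((\int[lebesgue_rV]_z
    (h (x + y, x + y + z)%R * (heat_kernel u z)%:E)) * (heat_kernel s y)%:E).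
Proof.
move=> s0 u0 mh h0.
have su0 : (0 <= s + u)%R by rewrite addr_ge0// ltW.
pose X1 w := (B s w - B 0%R w)%R; pose X2 w := (B (s + u)%R w - B s w)%R.
have mX1 : measurable_fun setT X1 by apply: measurable_increment => //;
  exact: ltW.
have mX2 : measurable_fun setT X2 by apply: measurable_increment => //;
  exact: ltW.
pose Y1 : {mfun T >-> 'rV[R]_n} :=
  HB.pack X1 (isMeasurableFun.Build _ _ _ _ X1 mX1).
pose Y2 : {mfun T >-> 'rV[R]_n} :=
  HB.pack X2 (isMeasurableFun.Build _ _ _ _ X2 mX2).
have mX12 : measurable_fun setT (fun w => (X1 w, X2 w)).
  exact: measurable_fun_pair.
have indep A C : measurable A -> measurable C ->
    pushforward P (fun w => (X1 w, X2 w)) (A `*` C) =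
    distribution P Y1 A * distribution P Y2 C.
  move=> mA mC.
  (* The times 0, s, s + u; the third is the default value of [nth]. *)
  pose t (i : nat) : R := nth (s + u)%R [:: 0; s]%R i.
  have H := @bm_independent _ _ _ _ _ _ _ hB 2 t (lexx 0%R) _
    (fun i : 'I_2 => if i == ord0 then A else C).
  rewrite /= in H.
  rewrite /pushforward (_ : _ @^-1` _ = \bigcap_(i in [set: 'I_2])
      (fun w => B (t i.+1) w - B (t i) w)%R @^-1` (if i == ord0 then A else C)).
    rewrite H.
    + by rewrite big_ord_recl big_ord1.
    + by move=> [|[|]]//= _; rewrite ?ltrDl.
    + by move=> i; case: ifP.
  apply/seteqP; split=> w /=.
    by move=> [wA wC] [[|[|//]] i2] _ /=.
  by move=> wAC; split; [exact: (wAC ord0)|exact: (wAC (lift ord0 ord0))].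
pose h' (p : 'rV[R]_n * 'rV[R]_n) := h (x + p.1, x + p.1 + p.2)%R.
have mh' : measurable_fun setT h'.
  apply: (measurableT_comp mh); apply/measurable_fun_pair => /=.
    exact: (measurableT_comp (measurable_addrV x)).
  apply/measurable_fun_rVP => i; under eq_fun do rewrite !mxE.
  apply: measurable_funD.
    by apply: measurable_funD => //;
      apply: (measurableT_comp (measurable_coord i)).
  by apply: (measurableT_comp (measurable_coord i)).
transitivity (\int[P]_w h' (X1 w, X2 w)).
  apply: eq_integral => w _; rewrite /h'/X1/X2/= (bm_start hB).
  by rewrite (addrC x) subrK (addrC (B s w)) subrK.
transitivity (\int[pushforward P (fun w => (X1 w, X2 w))]_p h' p).
  by rewrite ge0_integral_pushforward// => p _; exact: h0.
rewrite (eq_measure_integral (distribution P Y1 \x distribution P Y2));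
  last first.
  by move=> A mA _; apply/esym; apply: product_measure_unique.
rewrite fubini_tonelli1//; last by move=> p; exact: h0.
rewrite /fubini_F.
transitivity (\int[distribution P Y1]_y \int[lebesgue_rV]_z
    (h' (y, z) * (heat_kernel u z)%:E)).
  apply: eq_integral => y _.
  rewrite ge0_integral_distribution//.
  - have -> : u = (s + u - s)%R by rewrite addrAC subrr add0r.
    apply: (@integral_increment s (s + u)%R (fun z => h' (y, z))).
    + exact: ltW.
    + by rewrite ltrDl.
    + exact: (measurableT_comp mh' (pair1_measurable y)).
    + by move=> z; exact: h0.
  - exact: (measurableT_comp mh' (pair1_measurable y)).
  - by move=> z; exact: h0.
have mF : measurable_fun setT (fun y => \int[lebesgue_rV]_z
    (h' (y, z) * (heat_kernel u z)%:E)).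
  apply: (@measurable_fun_fubini_tonelli_F _ _ _ _ _ lebesgue_rV
    (fun p => h' p * (heat_kernel u p.2)%:E)).
  - apply: emeasurable_funM => //; apply/measurable_EFinP.
    exact: (measurableT_comp (@measurable_heat_kernel R n u)).
  - by move=> p; rewrite mule_ge0 ?h0// lee_fin heat_kernel_ge0.
rewrite ge0_integral_distribution//; last first.
  by move=> y; apply: integral_ge0 => z _;
    rewrite mule_ge0 ?h0// lee_fin heat_kernel_ge0.
rewrite (@integral_increment 0%R s _ (lexx _) s0 mF) ?subr0//.
by move=> y; apply: integral_ge0 => z _;
  rewrite mule_ge0 ?h0// lee_fin heat_kernel_ge0.
Qed.

End brownian_laws.

(** * Moments of the occupation integral *)

Section perpetual_moments.
Context (R : realType) (n : nat) dT (T : measurableType dT)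
  (P : probability T R) (x : 'rV[R]_n) (B : R -> T -> 'rV[R]_n)
  (hB : brownian_motion P x B) (f : 'rV[R]_n -> R) (cf : continuous f)
  (f_ge0 : forall y, (0 <= f y)%R).
Local Open Scope ereal_scope.
Local Notation mu := (@lebesgue_measure R).

(** Unlike the perpetual integral it keeps the value +oo on divergent paths. The end [s] is excluded
    because the heat kernel gives the law of an increment only over a positive time. *)
Definition occupation (s : R) (w : T) : \bar R :=
  \int[mu]_(t in `]s, +oo[) (f (B t w))%:E.

Let F (p : measurableTypeR R * T) : \bar R := (f (B (Num.max 0%R p.1) p.2))%:E.

Let mF : measurable_fun setT F.
Proof. by apply/measurable_EFinP; exact: measurable_path_eval hB _ cf. Qed.

Let F0 p : 0 <= F p.
Proof. by rewrite lee_fin. Qed.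

Let FE t w : (0 <= t)%R -> F (t, w) = (f (B t w))%:E.
Proof. by move=> t0; rewrite /F/= max_r. Qed.

Let mFw w : measurable_fun setT (fun t => F (t, w)).
Proof. exact: (measurableT_comp mF (pair2_measurable w)). Qed.

Let mf : measurable_fun setT (EFin \o f).
Proof. by apply/measurable_EFinP; exact: continuous_rV_measurable. Qed.

Let occE s w : (0 <= s)%R -> occupation s w = \int[mu]_(t in `]s, +oo[) F (t,
  w).
Proof.
move=> s0; apply: eq_integral => t; rewrite inE/= in_itv/= andbT => st.
by rewrite FE// (ltW (le_lt_trans s0 st)).
Qed.

Lemma occupation_ge0 s w : 0 <= occupation s w.
Proof. by apply: integral_ge0 => t _; rewrite lee_fin. Qed.

(** The moving lower end is transferred to the integrand as the indicator of s < t, after which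
    measurability of partial integrals applies. Joint measurability in time and chance is required
    for the second moment. *)
Lemma measurable_occupation2 : measurable_fun setT
  (fun p : measurableTypeR R * T => occupation (Num.max 0%R p.1) p.2).
Proof.
pose S := [set q : (measurableTypeR R * T) * measurableTypeR R |
  (Num.max 0%R q.1.1 < q.2)%R].
have mm : measurable_fun setT (fun t : measurableTypeR R => Num.max 0%R t :
  measurableTypeR R).
  by apply: measurable_maxr => //; exact: measurable_cst.
have mS : measurable S.
  rewrite -[S]setTI;
    apply: (@measurable_fun_ltr _ _ _ _ _ _ _ _ measurableT [set true]) => //.
  apply: (measurableT_comp mm);
    exact: (measurableT_comp measurable_fst measurable_fst).
pose G (q : (measurableTypeR R * T) * measurableTypeR R) :=
  F (q.2, q.1.2) * (\1_S q)%:E.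
have mG : measurable_fun setT G.
  apply: emeasurable_funM; last by apply/measurable_EFinP;
    exact: measurable_indic.
  apply: (measurableT_comp mF); apply/measurable_fun_pair => //=.
  exact: (measurableT_comp measurable_snd measurable_fst).
have G0 q : 0 <= G q by rewrite mule_ge0// lee_fin.
rewrite (_ : (fun _ => _) = (fun p => \int[mu]_t G (p, t))).
  exact: (@measurable_fun_fubini_tonelli_F _ _ _ _ _ mu _ mG G0).
apply/funext => p; rewrite occE ?le_max ?lexx//.
rewrite integral_mkcond; apply: eq_integral => t _.
rewrite patchE /G/= indicE.
have -> : (t \in `]Num.max 0%R p.1, +oo[%classic) = ((p, t) \in S).
  by apply/idP/idP; rewrite !inE /S/= in_itv/= andbT.
by case: ifPn; rewrite ?mule1 ?mule0.
Qed.

Lemma measurable_occupation s : (0 <= s)%R ->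
  measurable_fun setT (occupation s).
Proof.
move=> s0; have := measurableT_comp measurable_occupation2
  (pair1_measurable (s : measurableTypeR R)).
by apply: eq_measurable_fun => w _ /=; rewrite max_r.
Qed.

Let mK : measurable_fun setT
  (fun q : (measurableTypeR R * 'rV[R]_n) * 'rV[R]_n =>
    (f (q.1.2 + q.2))%:E * (heat_kernel q.1.1 q.2)%:E).
Proof.
apply: emeasurable_funM.
  apply: (measurableT_comp mf); apply: measurable_fun_addrV => //.
  exact: (measurableT_comp measurable_snd measurable_fst).
apply/measurable_EFinP.
have mp : measurable_fun setT
    (fun q : (measurableTypeR R * 'rV[R]_n) * 'rV[R]_n => (q.1.1, q.2)).
  apply/measurable_fun_pair => //=.
  exact: (measurableT_comp measurable_fst measurable_fst).
exact: (measurableT_comp (@measurable_heat_kernel2 R n) mp).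
Qed.

Let mK1 : measurable_fun setT (fun p : measurableTypeR R * 'rV[R]_n =>
  \int[lebesgue_rV]_z ((f (p.2 + z))%:E * (heat_kernel p.1 z)%:E)).
Proof.
apply: (@measurable_fun_fubini_tonelli_F _ _ _ _ _ lebesgue_rV _ mK).
by move=> q; rewrite mule_ge0// lee_fin ?heat_kernel_ge0.
Qed.

Let mH : measurable_fun setT (fun p : measurableTypeR R * 'rV[R]_n =>
  \int[lebesgue_rV]_z ((f (x + p.2 + z))%:E * (heat_kernel p.1 z)%:E)).
Proof.
have mp : measurable_fun setT
    (fun p : measurableTypeR R * 'rV[R]_n => (p.1, x + p.2)%R).
  apply/measurable_fun_pair => //=.
  exact: (measurableT_comp (measurable_addrV x) measurable_snd).
exact: (measurableT_comp mK1 mp).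
Qed.

(** The Markov property at time [s] in integrated form. After the shift t = s + u and an exchange of
    integrals, each u involves only the law of (B_s, B_(s+u)); integrating back over u rebuilds the
    potential at x + y. *)
Lemma integral_occupation s (g : 'rV[R]_n -> \bar R) : (0 < s)%R ->
  measurable_fun setT g -> (forall y, 0 <= g y) ->
  \int[P]_w (g (B s w) * occupation s w) =
  \int[lebesgue_rV]_y (g (x + y)%R * potential (EFin \o f) (x + y)%R *
    (heat_kernel s y)%:E).
Proof.
move=> s0 mg g0.
have mgB : measurable_fun setT (fun w => g (B s w)).
  exact: (measurableT_comp mg (bm_measurable hB (ltW s0))).
transitivity (\int[P]_w \int[mu]_(u in `]0%R, +oo[)
    (g (B s w) * F (s + u, w)%R)).
  apply: eq_integral => w _; rewrite ge0_integralZl//; last first.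
    apply: measurable_funTS.
    exact: (measurableT_comp (mFw w) (measurable_translate s)).
  congr (_ * _); rewrite occE ?(ltW s0)//.
  rewrite -(@ge0_integral_translate _ s)//;
    last exact: measurable_funTS (mFw w).
  congr (integral _ _ _); apply/seteqP.
  by split=> t /=; rewrite !in_itv/= !andbT ltrDl.
have mgF : measurable_fun setT (fun p : measurableTypeR R * T =>
    g (B s p.2) * F (s + p.1, p.2)%R).
  have ms : measurable_fun setT (fun p : measurableTypeR R * T => (s + p.1,
    p.2)%R).
    apply/measurable_fun_pair => //=.
    exact: (measurableT_comp (measurable_translate s) measurable_fst).
  apply: emeasurable_funM; first exact: (measurableT_comp mgB measurable_snd).
  exact: (measurableT_comp mF ms).
have gF0 (p : measurableTypeR R * T) : 0 <= g (B s p.2) * F (s + p.1, p.2)%R.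
  by rewrite mule_ge0.
apply: (etrans (esym (tonelli_in mu P (measurable_itv _) mgF gF0))).
pose H (p : measurableTypeR R * 'rV[R]_n) :=
  (g (x + p.2)%R * (heat_kernel s p.2)%:E) *
  \int[lebesgue_rV]_z ((f (x + p.2 + z))%:E * (heat_kernel p.1 z)%:E).
have mgp : measurable_fun setT (fun y : 'rV[R]_n => g (x +
  y)%R * (heat_kernel s y)%:E).
  apply: emeasurable_funM;
    first exact: (measurableT_comp mg (measurable_addrV x)).
  by apply/measurable_EFinP; exact: measurable_heat_kernel.
have mH' : measurable_fun setT H.
  by apply: emeasurable_funM => //;
    exact: (measurableT_comp mgp measurable_snd).
have gp0 y : 0 <= g (x + y)%R * (heat_kernel s y)%:E.
  by rewrite mule_ge0// lee_fin ?heat_kernel_ge0.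
have fp0 (p : measurableTypeR R * 'rV[R]_n) :
    0 <= \int[lebesgue_rV]_z ((f (x + p.2 + z))%:E * (heat_kernel p.1 z)%:E).
  by apply: integral_ge0 => z _; rewrite mule_ge0// lee_fin ?heat_kernel_ge0.
have H0 p : 0 <= H p by rewrite mule_ge0.
transitivity (\int[mu]_(u in `]0%R, +oo[) \int[lebesgue_rV]_y H (u, y)).
  apply: eq_integral => u; rewrite inE/= in_itv/= andbT => u0.
  have su0 : (0 <= s + u)%R by rewrite addr_ge0 ?ltW.
  under eq_integral do rewrite FE//.
  rewrite (@integral_bm2 _ _ _ _ _ _ _ hB s u (fun p => g p.1 * (f p.2)%:E))//.
  - apply: eq_integral => y _; rewrite /H/= muleAC; congr (_ * _).
    under eq_integral do rewrite -muleA.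
    rewrite ge0_integralZl// => [|z _]; last first.
      by rewrite mule_ge0// lee_fin ?heat_kernel_ge0.
    exact: (measurableT_comp mK (pair1_measurable ((u : measurableTypeR R), (x +
      y)%R))).
  - apply: emeasurable_funM; first exact: (measurableT_comp mg measurable_fst).
    exact: (measurableT_comp mf measurable_snd).
  - by move=> p; rewrite mule_ge0// lee_fin.
apply: (etrans (tonelli_in mu lebesgue_rV (measurable_itv _) mH' H0)).
apply: eq_integral => y _; rewrite /H/= ge0_integralZl//.
- by rewrite muleAC.
- apply: measurable_funTS; exact: (measurableT_comp mH (pair2_measurable y)).
- by move=> u _; exact: (fp0 (u, y)).
Qed.

Lemma measurable_potential : measurable_fun setT (potential (EFin \o f)).
Proof.
apply: (measurable_fun_integral_in mu (measurable_itv _) mK1) => p.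
by apply: integral_ge0 => z _; rewrite mule_ge0// lee_fin ?heat_kernel_ge0.
Qed.

Lemma integral_occupation0 : \int[P]_w occupation 0 w = potential (EFin \o f) x.
Proof.
under eq_integral do rewrite occE//.
apply: (etrans (esym (tonelli_in mu P (measurable_itv _) mF F0))).
apply: eq_integral => t.
rewrite inE/= in_itv/= andbT => t0.
under eq_integral do rewrite FE ?(ltW t0)//.
by rewrite (@integral_bm _ _ _ _ _ _ _ hB t (EFin \o f)).
Qed.

Lemma integral_occupation0_sqr : \int[P]_w (occupation 0 w ^+ 2) =
  2%:E * potential (fun y => (f y)%:E * potential (EFin \o f) y) x.
Proof.
transitivity (\int[P]_w (2%:E * \int[mu]_(s in `]0%R, +oo[)
    (F (s, w) * occupation (Num.max 0%R s) w))).
  apply: eq_integral => w _; rewrite occE// (ge0_integral_sqr (mFw w))//.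
  congr (_ * _); apply: eq_integral => s; rewrite inE/= in_itv/= andbT => s0.
  by rewrite max_r ?(ltW s0)// occE ?(ltW s0).
have mG : measurable_fun setT (fun p : measurableTypeR R * T =>
    F p * occupation (Num.max 0%R p.1) p.2).
  by apply: emeasurable_funM => //; exact: measurable_occupation2.
have G0 (p : measurableTypeR R * T) : 0 <= F p * occupation (Num.max 0%R p.1)
  p.2.
  by rewrite mule_ge0// occupation_ge0.
have mI := measurable_fun_integral_in mu (measurable_itv `]0%R, +oo[) mG G0.
have I0 : forall w : T, setT w -> 0 <= \int[mu]_(s in `]0%R, +oo[)
    (F (s, w) * occupation (Num.max 0%R s) w).
  by move=> w _; apply: integral_ge0 => s _; exact: (G0 (s, w)).
apply: (etrans (ge0_integralZl P measurableT mI I0 (_ : 0 <= 2%:E)) _) => //.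
congr (_ * _).
apply: (etrans (esym (tonelli_in mu P (measurable_itv _) mG G0))).
apply: eq_integral => s.
rewrite inE/= in_itv/= andbT => s0.
transitivity (\int[P]_w ((f (B s w))%:E * occupation s w)).
  by apply: eq_integral => w _; rewrite FE ?(ltW s0)// max_r ?(ltW s0).
by rewrite (@integral_occupation s (EFin \o f)).
Qed.

End perpetual_moments.

(** * Non-constancy *)

Section positive_box.
Context (R : realType) (n : nat).

Lemma lebesgue_rV_open_box (v : 'rV[R]_n) (e : R) : 0 < e ->
  lebesgue_rV [set y | forall i, `]v ord0 i - e, v ord0 i +
    e[%classic (y ord0 i)] != 0%E.
Proof.
move=> e0; rewrite (@lebesgue_rV_box R n (fun i => `]v ord0 i - e, v ord0 i +
  e[%classic))//.
rewrite (eq_bigr (fun=> (e + e)%:E)); last first.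
  move=> i _;
    rewrite lebesgue_measure_itv/= lte_fin ltrBlDr -addrA ltrDl addr_gt0//.
  by rewrite -EFinD; congr EFin; ring.
by rewrite prodEFin eqe prodr_const expf_neq0// gt_eqF// addr_gt0.
Qed.

(** Balls of the sup norm are boxes, so a ball around [y0] on which f does not vanish has positive
    measure; it is translated because laws are written around [x]. *)
Lemma continuous_neq0_positive_measure (f : 'rV[R]_n -> R) y0 (x : 'rV[R]_n) :
  continuous f -> f y0 != 0 ->
  exists A, [/\ measurable A, lebesgue_rV A != 0%E & forall y, A y ->
    f (x + y) != 0].
Proof.
move=> cf fy0.
have : nbhs y0 [set y | f y != 0].
  by apply: (cf y0 [set r | r != 0]); apply: open_nbhs_nbhs.
rewrite -nbhs_ballE => -[e /= e0 eA].
pose A' := [set y : 'rV[R]_n | forall i, `]y0 ord0 i - e, y0 ord0 i +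
  e[%classic (y ord0 i)].
have mA' : measurable A'.
  exact: (@measurable_box R n (fun i => `]y0 ord0 i - e, y0 ord0 i +
    e[%classic)).
exists [set y | A' (x + y)]; split.
- by rewrite -[X in measurable X]setTI; exact: (measurable_addrV x).
- by rewrite lebesgue_rV_translate//; exact: lebesgue_rV_open_box.
- move=> y Ay; apply: eA; split=> // i j; rewrite ord1.
  have := Ay j; rewrite /= in_itv/= => /andP[a b].
  by rewrite /ball/= ltr_distlC a b.
Qed.

End positive_box.

Section nonconstancy.
Context (R : realType) (n : nat) dT (T : measurableType dT)
  (P : probability T R) (x : 'rV[R]_n) (B : R -> T -> 'rV[R]_n)
  (hB : brownian_motion P x B) (f : 'rV[R]_n -> R) (cf : continuous f)
  (f_ge0 : forall y, (0 <= f y)%R).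
Local Open Scope ereal_scope.
Local Notation mu := (@lebesgue_measure R).
Local Notation U := (potential (EFin \o f)).
Local Notation occ := (occupation B f).

Let mf : measurable_fun setT (EFin \o f).
Proof. by apply/measurable_EFinP; exact: continuous_rV_measurable. Qed.

Let mU : measurable_fun setT U := measurable_potential cf f_ge0.

Lemma occupation_split t w : (0 <= t)%R ->
  occ 0 w = \int[mu]_(s in `]0%R, t]) (f (B (Num.max 0%R s) w))%:E + occ t w.
Proof.
move=> t0; have mF : measurable_fun setT (fun s : measurableTypeR R =>
    (f (B (Num.max 0%R s) w))%:E).
  by apply/measurable_EFinP; exact: (measurable_path hB w cf).
have E s : (0 <= s)%R ->
    occ s w = \int[mu]_(r in `]s, +oo[) (f (B (Num.max 0%R r) w))%:E.
  move=> s0; apply: eq_integral => r; rewrite inE/= in_itv/= andbT => sr.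
  by rewrite max_r// (ltW (le_lt_trans s0 sr)).
rewrite !E// (@itv_bndbnd_setU _ _ _ (BRight t)) ?bnd_simp//.
rewrite ge0_integral_setU//=.
- exact: measurable_funTS.
- by move=> r _; rewrite lee_fin.
- apply/disj_set2P; apply/seteqP; split=> // r [] /=; rewrite !in_itv/= andbT.
  by move=> /andP[_ rt] /(le_lt_trans rt); rewrite ltxx.
Qed.

Lemma occupation_le (M : R) t w : (0 <= t)%R -> (forall y, (f y <= M)%R) ->
  occ 0 w <= (t * M)%:E + occ t w.
Proof.
move=> t0 fM; rewrite (occupation_split w t0) leeD2r//.
apply: (@le_trans _ _ (\int[mu]_(s in `]0%R, t]) cst M%:E s)).
  apply: ge0_le_integral => //.
  - by move=> s _; rewrite lee_fin.
  - by apply: measurable_funTS; apply/measurable_EFinP;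
    exact: (measurable_path hB w cf).
  - by move=> s _; rewrite lee_fin.
rewrite integral_cst//= lebesgue_measure_itv/= lte_fin; case: ltP => t0'.
  by rewrite oppr0 adde0 -EFinM mulrC.
by rewrite mule0 lee_fin mulr_ge0// (le_trans _ (fM 0%R)).
Qed.

Lemma integral_occupation_start t : (0 <= t)%R ->
  \int[P]_w occ 0 w =
  \int[mu]_(s in `]0%R, t]) \int[lebesgue_rV]_y ((f (x +
    y))%:E * (heat_kernel s y)%:E)
  + \int[P]_w occ t w.
Proof.
move=> t0; under eq_integral do rewrite (occupation_split _ t0).
have mF : measurable_fun setT (fun p : measurableTypeR R * T =>
    (f (B (Num.max 0%R p.1) p.2))%:E).
  by apply/measurable_EFinP; exact: (measurable_path_eval hB cf).
have F0 (p : measurableTypeR R * T) : 0 <= (f (B (Num.max 0%R p.1) p.2))%:E.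
  by rewrite lee_fin.
rewrite ge0_integralD//; last 4 first.
- by move=> w _; apply: integral_ge0 => s _; rewrite lee_fin.
- exact: (measurable_fun_integral_in mu (measurable_itv _) mF F0).
- by move=> w _; exact: occupation_ge0.
- exact: (measurable_occupation hB cf f_ge0).
congr (_ + _).
apply: (etrans (esym (tonelli_in mu P (measurable_itv _) mF F0))).
apply: eq_integral => s; rewrite inE/= in_itv/= => /andP[s0 _].
under eq_integral do rewrite max_r ?(ltW s0)//.
by rewrite (@integral_bm _ _ _ _ _ _ _ hB s (EFin \o f)).
Qed.

Context (M : R) (fM : forall y, (f y <= M)%R) (C : R) (UC : forall v,
  U v <= C%:E).

Let U0 v : 0 <= U v.
Proof. by apply: potential_ge0 => y; rewrite lee_fin. Qed.

Let Ufin v : U v \is a fin_num.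
Proof. by rewrite ge0_fin_numE// (le_lt_trans (UC v))// ltry. Qed.

Let u v := fine (U v).

Let uE v : U v = (u v)%:E.
Proof. by rewrite /u fineK. Qed.

Let mux : measurable_fun setT (fun y => u (x + y)%R).
Proof.
apply: (measurableT_comp (@fine_measurable R setT measurableT)).
exact: (measurableT_comp mU (measurable_addrV x)).
Qed.

(** Let a = c - t M, g the indicator of {U < a} and O_t the functional from time t on. Almost surely
    O_t >= a, so E[g(B_t) a] <= E[g(B_t) O_t] = E[g(B_t) U(B_t)]. Hence the nonnegative g(B_t) (a -
    U(B_t)) has mean 0, and the density of B_t - x is positive everywhere. *)
Lemma potential_lt_null (c t : R) : (0 < t)%R ->
  {ae P, forall w, occ 0 w = c%:E} ->
  lebesgue_rV [set y | (u (x + y) < c - t * M)%R] = 0.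
Proof.
move=> t0 occ0; set a := (c - t * M)%R.
(* If a <= 0 the set is empty because U >= 0; below, a > 0 keeps all integrands nonnegative. *)
have [a0|a0] := leP a 0%R.
  rewrite (_ : mkset _ = set0) ?measure0//; apply/seteqP; split=> // y /= ya.
  have := lt_le_trans ya a0; rewrite ltNge => /negP; apply.
  by rewrite -lee_fin -uE.
pose D := [set v | (u v < a)%R].
have mu_ : measurable_fun setT u.
  exact: (measurableT_comp (@fine_measurable R setT measurableT) mU).
have mD : measurable D.
  rewrite -[D]setTI.
  exact: (@measurable_fun_ltr _ _ _ _ u (cst a) mu_ (measurable_cst _)
    measurableT [set true]).
pose g (v : 'rV[R]_n) : \bar R := (\1_D v)%:E.
have mg : measurable_fun setT g by apply/measurable_EFinP;
  exact: measurable_indic.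
have g0 v : 0 <= g v by rewrite lee_fin.
have mgx : measurable_fun setT (fun y => g (x + y)%R).
  exact: (measurableT_comp mg (measurable_addrV x)).
have mp : measurable_fun setT (fun y : 'rV[R]_n => (heat_kernel t y)%:E).
  by apply/measurable_EFinP; exact: measurable_heat_kernel.
have p0 (y : 'rV[R]_n) : 0 <= (heat_kernel t y)%:E by rewrite lee_fin
  heat_kernel_ge0.
have mx : measurable [set y | D (x + y)%R].
  by rewrite -[X in measurable X]setTI; exact: (measurable_addrV x).
have mgB : measurable_fun setT (fun w => g (B t w)).
  exact: (measurableT_comp mg (bm_measurable hB (ltW t0))).
pose I1 := \int[lebesgue_rV]_y (g (x + y)%R * U (x +
  y)%R * (heat_kernel t y)%:E).
pose I2 := \int[lebesgue_rV]_y (g (x + y)%R * (a - u (x +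
  y))%:E * (heat_kernel t y)%:E).
have mi1 : measurable_fun setT
    (fun y => g (x + y)%R * U (x + y)%R * (heat_kernel t y)%:E).
  have mUx := measurableT_comp mU (measurable_addrV x).
  exact: (emeasurable_funM (emeasurable_funM mgx mUx) mp).
have mi2 : measurable_fun setT
    (fun y => g (x + y)%R * (a - u (x + y))%:E * (heat_kernel t y)%:E).
  apply: (emeasurable_funM (emeasurable_funM mgx _) mp).
  by apply/measurable_EFinP; exact: (measurable_funB (measurable_cst a) mux).
have i1 y : 0 <= g (x + y)%R * U (x + y)%R * (heat_kernel t y)%:E.
  by rewrite !mule_ge0.
have i2 y : 0 <= g (x + y)%R * (a - u (x + y))%:E * (heat_kernel t y)%:E.
  rewrite mule_ge0// /g indicE; have [|_] := boolP (_ \in D);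
    last by rewrite mul0e.
  by rewrite inE mul1e lee_fin subr_ge0 => /ltW.
have I12 : I1 + I2 = \int[lebesgue_rV]_y (g (x +
  y)%R * a%:E * (heat_kernel t y)%:E).
  rewrite /I1 /I2 -ge0_integralD//; apply: eq_integral => y _.
  rewrite uE /g -!EFinM -EFinD; congr EFin; ring.
(* Boundedness of U enters here: [I1] must be finite to be cancelled from I1 + I2 <= I1. *)
have I1_lty : I1 \is a fin_num.
  rewrite ge0_fin_numE ?integral_ge0//.
  apply: (@le_lt_trans _ _ (\int[lebesgue_rV]_y (C%:E * (heat_kernel t y)%:E))).
    apply: ge0_le_integral => //; first exact: measurable_funeM.
    move=> y _; rewrite lee_wpmul2r//; apply: le_trans (UC (x + y)%R).
    by rewrite -[leRHS]mul1e lee_wpmul2r// lee_fin indicE; case: (_ \in _).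
  rewrite ge0_integralZl//; last exact: le_trans (U0 0%R) (UC 0%R).
  by rewrite (heat_kernel_mass hB t0) mule1 ltry.
have I2_0 : I2 = 0.
  apply/eqP; rewrite eq_le integral_ge0 ?andbT//.
  rewrite -(@leeD2lE _ I1)// adde0 I12 /I1.
  rewrite -(@integral_occupation _ _ _ _ _ _ _ hB _ cf f_ge0 t g)//.
  rewrite -(@integral_bm _ _ _ _ _ _ _ hB t (fun v => g v * a%:E))//;
    last 2 first.
  - exact: (emeasurable_funM mg (measurable_cst _)).
  - by move=> v; rewrite mule_ge0// lee_fin ltW.
  apply: ae_ge0_le_integral => //.
  - by move=> w _; rewrite mule_ge0// lee_fin ltW.
  - exact: (emeasurable_funM mgB (measurable_cst _)).
  - by move=> w _; rewrite mule_ge0// occupation_ge0.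
  - exact: (emeasurable_funM mgB (measurable_occupation hB cf f_ge0 (ltW t0))).
  - move: occ0; apply: filterS => w ow _; rewrite lee_wpmul2l//.
    by rewrite /a EFinB leeBlDl// -ow; exact: occupation_le (ltW t0) fM.
apply: (@ge0_integral_eq0_measure0 _ _ _ _ setT _ _ _ _ _ _ _ I2_0) => //.
apply: aeW => y Dy; rewrite /g indicE mem_set// mul1e -EFinM eqe mulf_neq0//.
  by rewrite gt_eqF// subr_gt0.
by rewrite gt_eqF// heat_kernel_gt0.
Qed.

Lemma occupation_not_cst : (exists y, f y != 0%R) ->
  ~ exists c : R, {ae P, forall w, occ 0 w = c%:E}.
Proof.
move=> [y0 fy0] [c occ0].
have Uc : U x = c%:E.
  rewrite -(integral_occupation0 hB cf f_ge0).
  transitivity (\int[P]_w cst c%:E w).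
    apply: ae_eq_integral => //.
    - exact: (measurable_occupation hB cf f_ge0).
    - by move: occ0; apply: filterS.
  by rewrite integral_cst//= probability_setT mule1.
have c0 : (0 <= c)%R by rewrite -lee_fin -Uc.
(* The limit t -> 0 is taken along t = 1/(k+1), so that only countably many null sets are
   discarded. *)
have cU : {ae lebesgue_rV, forall y, (c <= u (x + y))%R}.
  have : forall k, {ae lebesgue_rV, forall y, (c - k.+1%:R^-1 * M <= u (x +
    y))%R}.
    move=> k; exists [set y | (u (x + y) < c - k.+1%:R^-1 * M)%R]; split.
    - rewrite -[X in measurable X]setTI.
      exact: (@measurable_fun_ltr _ _ _ _ _ (cst (c - k.+1%:R^-1 * M)%R)
        mux (measurable_cst _) measurableT [set true]).
    - by apply: potential_lt_null => //; rewrite invr_gt0.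
    - by move=> y /= /negP; rewrite -ltNge.
  move=> /ae_foralln; apply: filterS => y cy.
  apply/ler_addgt0Pr => e e0; rewrite -lerBlDr.
  apply: le_trans (cy (Num.bound (M / e))); rewrite lerB//.
  rewrite ler_pdivrMl// -ler_pdivrMr// ltW// (lt_le_trans (archi_boundP _))//.
    by rewrite divr_ge0 ?(ltW e0)// (le_trans _ (fM 0%R)).
  by rewrite ler_nat.
have occ1 : c%:E <= \int[P]_w occ 1 w.
  have -> : \int[P]_w occ 1 w =
      \int[lebesgue_rV]_y (U (x + y)%R * (heat_kernel 1 y)%:E).
    transitivity (\int[P]_w (cst 1 (B 1%R w) * occ 1 w)).
      by apply: eq_integral => w _; rewrite mul1e.
    rewrite (integral_occupation hB cf f_ge0 ltr01 (measurable_cst 1))//.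
    by apply: eq_integral => y _; rewrite mul1e.
  rewrite -[leLHS]mule1 -(heat_kernel_mass hB ltr01) -ge0_integralZl//;
    last 2 first.
  - by apply/measurable_EFinP; exact: measurable_heat_kernel.
  - by move=> y _; rewrite lee_fin heat_kernel_ge0.
  have mp : measurable_fun setT (fun y : 'rV[R]_n => (heat_kernel 1 y)%:E).
    by apply/measurable_EFinP; exact: measurable_heat_kernel.
  apply: ae_ge0_le_integral => //.
  - by move=> y _; rewrite mule_ge0// lee_fin heat_kernel_ge0.
  - exact: measurable_funeM.
  - by move=> y _; rewrite mule_ge0 ?lee_fin ?heat_kernel_ge0.
  - exact: (emeasurable_funM (measurableT_comp mU (measurable_addrV x)) mp).
  - move: cU; apply: filterS => y cy _.
    by rewrite lee_wpmul2r ?lee_fin ?heat_kernel_ge0// uE lee_fin.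
have Ige0 s : 0 <= \int[lebesgue_rV]_y ((f (x + y))%:E * (heat_kernel s y)%:E).
  by apply: integral_ge0 => y _; rewrite mule_ge0// lee_fin ?heat_kernel_ge0.
have A0 : \int[mu]_(s in `]0%R, 1%R]) \int[lebesgue_rV]_y
    ((f (x + y))%:E * (heat_kernel s y)%:E) = 0.
  have := integral_occupation_start (@ler01 R).
  rewrite (integral_occupation0 hB cf f_ge0) Uc; set A :=
    \int[mu]_(_ in _) _ => cE.
  have A_ge0 : 0 <= A by apply: integral_ge0.
  (* By [cE] this term is at most c; being finite, it cancels and leaves A <= 0. *)
  have Ofin : \int[P]_w occ 1 w \is a fin_num.
    rewrite ge0_fin_numE; last by apply: integral_ge0 => w _;
      exact: occupation_ge0.
    by rewrite (@le_lt_trans _ _ c%:E) ?ltry// cE leeDr.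
  apply/eqP; rewrite eq_le A_ge0 andbT -(@leeD2rE _ (\int[P]_w occ 1 w))//.
  by rewrite add0e -cE.
have mI := measurable_heat_shift x mf.
have [A [mA A_neq0 fA]] := continuous_neq0_positive_measure x cf fy0.
have : mu (`]0%R, 1%R]%classic : set R) = 0.
  apply: (@ge0_integral_eq0_measure0 _ _ _ _ _ _ _ _ _ _ _ _ A0) => //.
  - apply: measurable_funTS;
    apply: (@measurable_fun_fubini_tonelli_F _ _ _ _ _ lebesgue_rV _ mI).
    by move=> p; rewrite mule_ge0// lee_fin ?heat_kernel_ge0.
  - apply: aeW => s /=; rewrite in_itv/= => /andP[s0 _].
    (* At a time s > 0 the kernel is positive, so a vanishing space integral would make [A] null.
       Hence the integrand in s vanishes nowhere on ]0, 1], and that interval would be null. *)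
    apply/eqP => Is0; move/eqP : A_neq0; apply.
    apply: (@ge0_integral_eq0_measure0 _ _ _ _ setT _ _ _ _ _ _ _ Is0) => //.
    + exact: (measurableT_comp mI (pair1_measurable (s : measurableTypeR R))).
    + by move=> y _; rewrite mule_ge0// lee_fin ?heat_kernel_ge0.
    + apply: aeW => y Ay; rewrite -EFinM eqe mulf_neq0 ?fA//.
      by rewrite gt_eqF// heat_kernel_gt0.
rewrite lebesgue_measure_itv/= lte_fin ltr01 oppr0 adde0 => -[] /eqP.
by rewrite oner_eq0.
Qed.

End nonconstancy.

(** * The perpetual integral *)

Section perpetual.
Context (R : realType) (d : nat) (hd : (3 <= d)%N) dT (T : measurableType dT)
  (P : probability T R) (x : 'rV[R]_d) (B : R -> T -> 'rV[R]_d)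
  (hB : brownian_motion P x B) (f : 'rV[R]_d -> R) (hf : CL f)
  (f_ge0 : forall y, (0 <= f y)%R).
Local Open Scope ereal_scope.
Local Notation mu := (@lebesgue_measure R).
Local Notation U := (potential (EFin \o f)).
Local Notation occ := (occupation B f 0).
Local Notation X := (perpetual_integral f B).

Definition potential_const : R :=
  2 `^ (d%:R / 2 - 1) * Gamma (d%:R / 2 - 1) / (2 * pi) `^ (d%:R / 2).
Local Notation K := potential_const.

Let cf : continuous f. Proof. by case: hf. Qed.

Let mf : measurable_fun setT (EFin \o f).
Proof. by apply/measurable_EFinP; exact: continuous_rV_measurable. Qed.

Let mU : measurable_fun setT U := measurable_potential cf f_ge0.

Let U0 v : 0 <= U v.
Proof. by apply: potential_ge0 => y; rewrite lee_fin. Qed.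

Lemma CL_bounded : exists M : R, forall y, (f y <= M)%R.
Proof.
(* [bounded_fun] provides the bounds strictly above [M] only. *)
case: hf => _ [M [_ fM]] _; exists (M + 1)%R => y.
by apply: le_trans (ler_norm _) _; apply: (fM (M + 1)%R) => //; rewrite ltrDl.
Qed.

Lemma CL_integral_fin : \int[lebesgue_rV]_y (f y)%:E \is a fin_num.
Proof. by case: hf => _ _; exact: integrable_fin_num. Qed.

Lemma potential_bounded : exists C : R, forall v, U v <= C%:E.
Proof.
have [M fM] := CL_bounded.
exists (M + 2 * fine (\int[lebesgue_rV]_y (f y)%:E))%R => v.
rewrite EFinD EFinM fineK ?CL_integral_fin//.
apply: (potential_le (heat_kernel_mass hB) _ hd mf) => y; rewrite lee_fin//.
Qed.

(** [Gamma] is the real part of the extended integral, so this rests on its finiteness. *)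
Lemma GammaE : (Gamma (d%:R / 2 - 1) : R)%:E = gamma_integral R d.
Proof.
rewrite /Gamma /Rintegral fineK// ge0_fin_numE ?ltW ?gamma_integral_gt0//.
exact: gamma_integral_lty (heat_kernel_mass hB) hd.
Qed.

Lemma potential_const_gt0 : (0 < K)%R.
Proof.
have G0 : (0 < Gamma (d%:R / 2 - 1) :> R)%R by rewrite -lte_fin GammaE
  gamma_integral_gt0.
by rewrite divr_gt0 ?mulr_gt0// powR_gt0// mulr_gt0// pi_gt0.
Qed.

Lemma potential_constE (h : 'rV[R]_d -> \bar R) v : measurable_fun setT h ->
  (forall y, 0 <= h y) ->
  potential h v = K%:E * \int[lebesgue_rV]_y
    (h (v + y)%R * ((enorm y ^+ (d - 2))^-1)%:E).
Proof.
move=> mh h0; rewrite (potentialE _ (ltnW hd) mh h0) -GammaE.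
have mr : measurable_fun setT (fun y : 'rV[R]_d => ((enorm y ^+ (d -
  2))^-1)%:E).
  by apply/measurable_EFinP; exact: measurable_enorm_exprV.
have mhr := emeasurable_funM (measurableT_comp mh (measurable_addrV v)) mr.
have r0 (y : 'rV[R]_d) : 0 <= ((enorm y ^+ (d - 2))^-1)%:E.
  by rewrite lee_fin enorm_exprV_ge0.
have -> : K = (Gamma (d%:R / 2 - 1) * green_const R d)%R.
  by rewrite /potential_const /green_const mulrCA mulrA.
rewrite EFinM -muleA; congr (_ * _); rewrite -ge0_integralZl//.
- by apply: eq_integral => y _; rewrite EFinM muleCA.
- by move=> y _; rewrite mule_ge0.
- by rewrite lee_fin green_const_ge0.
Qed.

Lemma measurable_path_in w (D : set (measurableTypeR R)) : D `<=` `[0%R, +oo[ ->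
  measurable_fun D (fun t => (f (B t w))%:E).
Proof.
move=> D0; have := measurable_funTS (D := D) (measurable_path hB w cf).
move/measurable_EFinP; apply: eq_measurable_fun => t; rewrite inE => /D0.
by rewrite /= in_itv/= andbT => t0; rewrite max_r.
Qed.

Lemma occupationE w : \int[mu]_(t in `[0%R, +oo[) (f (B t w))%:E = occ w.
Proof.
rewrite -integral_itv_obnd_cbnd//; apply: measurable_path_in => t /=.
by rewrite !in_itv/= !andbT => /ltW.
Qed.

Lemma perpetual_integralE w : X w = fine (occ w).
Proof. by rewrite /perpetual_integral /Rintegral occupationE. Qed.

Let mocc : measurable_fun setT occ :=
  measurable_occupation hB cf f_ge0 (lexx 0%R).

Let occ0 w : 0 <= occ w. Proof. exact: occupation_ge0. Qed.

Lemma potential_fin v : U v \is a fin_num.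
Proof.
by have [C UC] := potential_bounded;
  rewrite ge0_fin_numE// (le_lt_trans (UC v))// ltry.
Qed.

(** The mean is U(x), which is finite. *)
Lemma occupation_ae_fin : {ae P, forall w, occ w \is a fin_num}.
Proof.
have : P.-integrable setT occ.
  apply/integrableP; split => //; under eq_integral do rewrite gee0_abs//.
  by rewrite (integral_occupation0 hB cf f_ge0) -ge0_fin_numE// potential_fin.
move=> /(integrable_ae measurableT); apply: filterS => w; exact.
Qed.

Lemma measurable_perpetual_integral : measurable_fun setT X.
Proof.
rewrite (_ : X = fine \o occ); last first.
  by apply/funext => w; rewrite perpetual_integralE.
exact: (measurableT_comp (@fine_measurable R setT measurableT) mocc).
Qed.

(** On divergent paths [X] is 0 whereas [occ] is +oo; these paths form a null event. *)
Lemma perpetual_integral_mean : \int[P]_w (X w)%:E = U x.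
Proof.
rewrite -(integral_occupation0 hB cf f_ge0); apply: ae_eq_integral => //.
  by apply/measurable_EFinP; exact: measurable_perpetual_integral.
move: occupation_ae_fin; apply: filterS => w ow _.
by rewrite perpetual_integralE fineK.
Qed.

Lemma perpetual_integral_sqr_mean : \int[P]_w (X w ^+ 2)%:E =
  2%:E * potential (fun y => (f y)%:E * U y) x.
Proof.
rewrite -(integral_occupation0_sqr hB cf f_ge0); apply: ae_eq_integral => //.
- apply/measurable_EFinP; apply: measurable_funX;
  exact: measurable_perpetual_integral.
- by apply: emeasurable_funM.
- move: occupation_ae_fin; apply: filterS => w ow _.
  by rewrite perpetual_integralE EFin_expe fineK.
Qed.

(** The product f U inherits boundedness and integrability from f because U is bounded, so
    [potential_le] applies once more. *)
Lemma potential2_fin : potential (fun y => (f y)%:E * U y) x \is a fin_num.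
Proof.
have [C UC] := potential_bounded; have [M fM] := CL_bounded.
have C0 : (0 <= C)%R by rewrite -lee_fin (le_trans (U0 0%R)).
have fU0 y : 0 <= (f y)%:E * U y by rewrite mule_ge0// lee_fin.
have mfU : measurable_fun setT (fun y => (f y)%:E * U y) by exact:
  emeasurable_funM.
rewrite ge0_fin_numE; last exact: potential_ge0.
have := potential_le (heat_kernel_mass hB) x hd mfU fU0.
move=> /(_ (M * C)%R) H; apply: (le_lt_trans (H _)) => {H}.
  by move=> y; rewrite EFinM lee_pmul// lee_fin.
rewrite lte_add_pinfty ?ltry// lte_mul_pinfty//.
apply: (@le_lt_trans _ _ (\int[lebesgue_rV]_y (C%:E * (f y)%:E))).
  apply: ge0_le_integral => //.
  - exact: measurable_funeM.
  - by move=> y _; rewrite muleC lee_wpmul2r// lee_fin.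
rewrite ge0_integralZl//; last by move=> y _; rewrite lee_fin.
by rewrite -(fineK CL_integral_fin) -EFinM ltry.
Qed.

Lemma perpetual_integral_Lfun2 : X \in Lfun P 2%:E.
Proof.
rewrite inE; apply/andP; split; rewrite inE/=.
  exact: measurable_perpetual_integral.
rewrite /finite_norm unlock; apply: poweR_lty.
rewrite (eq_integral (fun w => (X w ^+ 2)%:E)); last first.
  by move=> w _; rewrite /= powR_mulrn// real_normK// num_real.
rewrite perpetual_integral_sqr_mean -(fineK potential2_fin) -EFinM; exact: ltry.
Qed.

Local Notation I1 :=
  (\int[lebesgue_rV]_y (f (x + y) / enorm y ^+ (d - 2))%:E).
Local Notation I2 :=
  (\int[lebesgue_rV]_z \int[lebesgue_rV]_y
    (f (x + y) * f (x + y + z) /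
      (enorm y ^+ (d - 2) * enorm z ^+ (d - 2)))%:E).

Lemma potential_I1 : U x = K%:E * I1.
Proof.
by rewrite potential_constE.
Qed.

(** Each potential contributes one factor K. Unfolding them puts dz inside dy; [Q] takes its
    arguments as (z, y) so that Tonelli's theorem yields the order of [I2]. *)
Lemma potential_I2 :
  potential (fun y => (f y)%:E * U y) x = (K ^+ 2)%:E * I2.
Proof.
have mi := @measurable_enorm_exprV R d (d - 2).
have mfr := continuous_rV_measurable cf.
pose r (v : 'rV[R]_d) := ((enorm v ^+ (d - 2))^-1)%R.
have r0 v : (0 <= r v)%R := enorm_exprV_ge0 (d - 2) v.
pose Q (p : 'rV[R]_d * 'rV[R]_d) := (f (x + p.2) * f (x + p.2 + p.1) /
      (enorm p.2 ^+ (d - 2) * enorm p.1 ^+ (d - 2)))%R.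
have mQ : measurable_fun setT (EFin \o Q).
  have m2 := measurableT_comp (measurable_addrV x)
    (@measurable_snd _ _ 'rV[R]_d 'rV[R]_d).
  apply/measurable_EFinP; apply: measurable_funM.
    apply: measurable_funM; first exact: (measurableT_comp mfr m2).
    exact: (measurableT_comp mfr (measurable_fun_addrV m2 measurable_fst)).
  rewrite (_ : (fun _ => _) = (fun p : 'rV[R]_d * 'rV[R]_d =>
    (enorm p.2 ^+ (d - 2))^-1 * (enorm p.1 ^+ (d - 2))^-1)%R); last first.
    by apply/funext => p; rewrite invfM.
  apply: measurable_funM; first exact: (measurableT_comp mi measurable_snd).
  exact: (measurableT_comp mi measurable_fst).
have Q0 p : 0 <= (EFin \o Q) p.
  by rewrite lee_fin divr_ge0 ?mulr_ge0 ?exprn_ge0 ?enorm_ge0.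
have K0 := ltW potential_const_gt0.
have fU0 y : 0 <= (f y)%:E * U y by rewrite mule_ge0// lee_fin.
have mfU : measurable_fun setT (fun y => (f y)%:E * U y) by exact:
  emeasurable_funM.
rewrite potential_constE// expr2 (EFinM K K) -muleA; congr (_ * _).
have I2E : \int[lebesgue_rV]_y \int[lebesgue_rV]_z (Q (z, y))%:E = I2.
  have := @fubini_tonelli _ _ _ _ _ lebesgue_rV lebesgue_rV (EFin \o Q) mQ Q0.
  by rewrite /Q/= => ->.
transitivity (K%:E * \int[lebesgue_rV]_y \int[lebesgue_rV]_z (Q (z, y))%:E);
  last first.
  by rewrite I2E.
have mG : measurable_fun setT (fun y => \int[lebesgue_rV]_z (Q (z, y))%:E).
  exact: (@measurable_fun_fubini_tonelli_G _ _ _ _ _ lebesgue_rV (EFin \o Q) mQ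
    Q0).
have G0 : forall y, setT y -> 0 <= \int[lebesgue_rV]_z (Q (z, y))%:E.
  by move=> y _; apply: integral_ge0 => z _; exact: (Q0 (z, y)).
have K0E : 0 <= K%:E by rewrite lee_fin.
apply: (etrans _ (ge0_integralZl lebesgue_rV measurableT mG G0 K0E)).
have f0 y : 0 <= (EFin \o f) y := f_ge0 y.
apply: eq_integral => y _; rewrite (potential_constE (x + y)%R mf f0).
rewrite muleCA -2!muleA; congr (K%:E * _).
have mfyr : measurable_fun setT (fun z => (f (x + y + z))%:E * (r z)%:E).
  apply: emeasurable_funM; last exact/measurable_EFinP.
  exact: (measurableT_comp mf (measurable_addrV _)).
have fyr0 : forall z, setT z -> 0 <= (f (x + y + z))%:E * (r z)%:E.
  by move=> z _; apply: mule_ge0; rewrite lee_fin.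
have c0 : 0 <= (f (x + y) * r y)%:E by exact: mulr_ge0.
have E := ge0_integralZl lebesgue_rV measurableT mfyr fyr0 c0.
transitivity ((f (x + y) * r y)%:E *
    \int[lebesgue_rV]_z ((f (x + y + z))%:E * (r z)%:E)).
  by rewrite EFinM -muleA; congr (_ * _); rewrite muleC.
rewrite -E; apply: eq_integral => z _; rewrite -!EFinM; congr EFin.
by rewrite /Q/r/= invfM; ring.
Qed.

Lemma sqr_potential_const : (K ^+ 2 =
  2 ^+ (d - 2) * Gamma (d%:R / 2 - 1) ^+ 2 / (2 * pi) ^+ d)%R.
Proof.
have p0 : (0 <= 2 * pi :> R)%R by rewrite mulr_ge0 ?pi_ge0.
have sqr_powR (a b : R) : ((a `^ b) ^+ 2 = a `^ (b * 2))%R.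
  by rewrite powRrM powR_mulrn ?powR_ge0.
move: p0; rewrite /potential_const; move: (2 * pi)%R => c c0.
rewrite !exprMn exprVn !sqr_powR; congr (_ * _ / _)%R.
  rewrite -(@powR_mulrn _ 2 (d - 2))//; congr (_ `^ _)%R.
  by rewrite natrB ?(ltnW hd)//; field.
by rewrite -(powR_mulrn d c0); congr (_ `^ _)%R; field.
Qed.

End perpetual.

Theorem theorem1 (R : realType) (d : nat) (hd : (3 <= d)%N)
    (dT : measure_display) (T : measurableType dT) (P : probability T R)
    (x : 'rV[R]_d) (B : R -> T -> 'rV[R]_d) (hB : brownian_motion P x B)
    (f : 'rV[R]_d -> R) (hf : CL f) (f_ge0 : forall y, 0 <= f y) :
  let X : T -> R := perpetual_integral f B in
  let I1 : \bar R :=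
    (\int[lebesgue_rV]_y (f (x + y) / enorm y ^+ (d - 2))%:E)%E in
  let I2 : \bar R :=
    (\int[lebesgue_rV]_z \int[lebesgue_rV]_y
      (f (x + y) * f (x + y + z) /
        (enorm y ^+ (d - 2) * enorm z ^+ (d - 2)))%:E)%E in
  let V : \bar R :=
    ((2 ^+ (d - 2) * Gamma (d%:R / 2 - 1) ^+ 2 / (2 * pi) ^+ d)%:E
      * (2%:E * I2 - I1 ^+ 2))%E in
  [/\ {ae P, forall w,
        lebesgue_measure.-integrable `[0, +oo[ (fun t => (f (B t w))%:E)},
      measurable_fun setT X,
      ('E_P[X] \is a fin_num)%E /\
      ('E_P[X] =
        (2 `^ (d%:R / 2 - 1) * Gamma (d%:R / 2 - 1)
          / (2 * pi) `^ (d%:R / 2))%:E * I1)%E,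
      ('V_P[X] \is a fin_num)%E /\ ('V_P[X] = V)%E &
      (exists y, f y != 0) ->
        ~ (exists c : R, {ae P, forall w, X w = c}) /\ (0 < V)%E].
Proof.
move=> X I1 I2 V.
have cf : continuous f by case: hf.
have mX : measurable_fun setT X := measurable_perpetual_integral hB hf f_ge0.
have X2 : X \in Lfun P 2%:E := perpetual_integral_Lfun2 hd hB hf f_ge0.
have EX : ('E_P[X] = potential (EFin \o f) x)%E.
  by rewrite unlock; exact: perpetual_integral_mean.
have EXfin : 'E_P[X]%E \is a fin_num by rewrite EX; exact: (potential_fin hd hB hf f_ge0).
have VX : 'V_P[X]%E = V.
  rewrite varianceE// EX.
  have -> : 'E_P[X ^+ 2]%E =
      (2%:E * potential (fun y => (f y)%:E * potential (EFin \o f) y) x)%E.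
    by rewrite unlock -(perpetual_integral_sqr_mean hd hB hf f_ge0).
  have K0 := potential_const_gt0 hd hB.
  have U1 := potential_I1 hd hB hf f_ge0.
  have U2 := potential_I2 hd hB hf f_ge0.
  have fin1 := potential_fin hd hB hf f_ge0 x.
  have fin2 := potential2_fin hd hB hf f_ge0.
  rewrite /V -(sqr_potential_const _ hd) -/I1 -/I2 in U1 U2 *.
  (* Positivity of K brings finiteness of the potentials down to [I1] and [I2], after which the
     variance formula is an identity between real numbers. *)
  have fin_of (k : R) (e : \bar R) : 0 < k ->
      (k%:E * e)%E \is a fin_num -> e \is a fin_num.
    by move=> k0; case: e => // ; rewrite ?gt0_muley ?gt0_muleNy ?lte_fin.
  have I1fin : I1 \is a fin_num by move: fin1; rewrite U1; exact: fin_of.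
  have I2fin : I2 \is a fin_num.
    by move: fin2; rewrite U2; apply: fin_of; exact: exprn_gt0.
  rewrite U1 U2 -(fineK I1fin) -(fineK I2fin).
  rewrite -!EFinM -!EFin_expe -?EFinM -?EFinB -?EFinM; congr EFin; ring.
have occ_fin := occupation_ae_fin hd hB hf f_ge0.
split => //.
- move: occ_fin; apply: filterS => w ow; apply/integrableP; split.
    exact: (measurable_path_in hB hf).
  under eq_integral do rewrite gee0_abs ?lee_fin//.
  by rewrite (occupationE hB hf) -ge0_fin_numE// occupation_ge0.
- by split=> //; rewrite EX; exact: (potential_I1 hd hB hf f_ge0).
- by split=> //; exact: variance_fin_num X2.
move=> fy.
have ncst : ~ (exists c : R, {ae P, forall w, X w = c}).
  move=> [c Xc].
  have [M fM] := CL_bounded hf; have [C UC] := potential_bounded hd hB hf f_ge0.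
  apply: (occupation_not_cst hB cf f_ge0 fM UC fy); exists c.
  move: occ_fin Xc; apply: filterS2 => w ow <-.
  by rewrite /X (perpetual_integralE hB hf) fineK.
split=> //; rewrite -VX lt_neqAle variance_ge0 andbT; apply/eqP => V0.
(* A zero variance makes the square of X - m vanish almost surely, so X would equal its mean. *)
apply: ncst; exists (fine 'E_P[X]%E); move: V0.
rewrite /variance unlock; set m := fine _; rewrite unlock => /esym V0.
have mY : measurable_fun setT (fun w => ((X w - m) * (X w - m))%:E).
  apply/measurable_EFinP.
  by apply: measurable_funM; exact: (measurable_funB mX (measurable_cst m)).
have /(ae_eq_integral_abs P measurableT mY) :
    (\int[P]_w `|((X w - m) * (X w - m))%:E| = 0)%E.
  by rewrite -V0; apply: eq_integral => w _; rewrite gee0_abs// lee_fin -expr2 sqr_ge0.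
apply: filterS => w /(_ I) [] /eqP.
by rewrite mulf_eq0 orbb subr_eq0 => /eqP.
Qed.
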